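(* Let $\{A(t);t\ge0\}$ be a non-homogeneous Poisson process on $[0,\infty)$ with rate function $\lambda$. For each $s\ge0$ let $B_s$ be a nonnegative random variable (law depending on $s$) and $F_s$ a CDF on $[0,\infty)$. For each integer $n\ge1$ consider the infinite-server queue in which batches arrive at the points of $A$, a batch arriving at time $s$ has size $B^{(n)}_s:=\lceil nB_s\rceil$, and given its size the customers of that batch bring i.i.d. amounts of work with CDF $F_s$, all batches being independent of each other and of $A$; each customer arriving at time $s$ with work $S$ departs at time $s+S$, and the system starts empty. Let $Q_n(t)$ be the number of customers present at time $t$ and $D_n(t)$ the number of departures in $(0,t]$, and set $\overline{Q}_n(t)=Q_n(t)/n$, $\overline{D}_n(t)=D_n(t)/n$. Then for every integer $m\ge1$, all $0=t_0<t_1<\dots<t_m$ and all $\alpha,\beta\in\mathbb{R}_+^m$, $$\lim_{n\to\infty}\mathbb{E}\Big[e^{-\sum_{k=1}^m(\alpha_k\overline{Q}_n(t_k)+\beta_k\overline{D}_n(t_k))}\Big]=\exp\Big(-\sum_{k=1}^m\int_{t_{k-1}}^{t_k}\mathbb{E}_s\Big[1-e^{-\left(\sum_{x=k}^m\left(\alpha_x\overline{F}_s(t_x-s)+\beta_xF_s(t_x-s)\right)\right)B_s}\Big]\lambda(s)\,ds\Big),$$ where $\mathbb{E}_s$ denotes expectation with respect to the law of $B_s$ and $\overline{F}_s=1-F_s$.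
   Context: This describes a batch-scaling of infinite-server queues with non-stationary Poisson batch arrivals; the limit is the joint Laplace transform of a Poisson-driven shot-noise process $Z(t)=\int_0^tB_s\overline{F}_s(t-s)A(ds)$ and its complement evaluated at finitely many times. *)

(* Defs.v *)
From HB Require Import structures.
From mathcomp Require Import all_boot all_order all_algebra.
From mathcomp Require Import all_classical all_reals all_analysis measurable_realfun.
Set Implicit Arguments. Unset Strict Implicit. Unset Printing Implicit Defensive.
Import Order.TTheory GRing.Theory Num.Theory.
Import numFieldNormedType.Exports.
Local Open Scope classical_set_scope.
Local Open Scope ring_scope.

Section defs.
Context {R : realType}.

(* Poisson probability P(X = c) for X ~ Poisson(L), L >= 0 (L = 0 gives Dirac at 0). *)
Definition poisson_prob (L : R) (c : nat) : R := expR (- L) * L ^+ c / c`!%:R.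

Definition Lambda (lam : R -> R) (s t : R) : R :=
  fine (\int[lebesgue_measure]_(x in `]s, t]) (lam x)%:E)%E.

Definition is_cdf_nonneg (F : R -> R) : Prop :=
  [/\ {homo F : x y / x <= y},
      (forall x, F y @[y --> x^'+] --> F x),
      (forall x, x < 0 -> F x = 0) &
      F x @[x --> +oo] --> (1 : R)].

Variables (d : measure_display) (Omega : measurableType d).

Definition count_in (tau : nat -> Omega -> \bar R) (s t : R) (w : Omega) : \bar R :=
  (\sum_(i <oo) (if (s%:E < tau i w)%E && (tau i w <= t%:E)%E then 1 else 0)%:E)%E.

(* The points (tau_i)_i (listed in nondecreasing order, +oo meaning "no i-th point")
   form a non-homogeneous Poisson process on [0, oo) with rate function lam:
   counts over consecutive disjoint intervals (u_j, u_{j+1}] are independent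
   Poisson(Lambda u_j u_{j+1}) variables, and a.s. there is no point in (-oo, 0]. *)
Definition poisson_points (P : probability Omega R) (lam : R -> R)
    (tau : nat -> Omega -> \bar R) : Prop :=
  [/\ (forall i, measurable_fun setT (tau i)),
      (forall i w, (tau i w <= tau i.+1 w)%E),
      P [set w | forall i, (0%:E < tau i w)%E] = 1%E &
      (forall (q : nat) (u : nat -> R) (c : nat -> nat),
         0 <= u 0%N -> (forall j, (j < q)%N -> u j < u j.+1) ->
         P (\bigcap_(j in [set j | (j < q)%N]) [set w | count_in tau (u j) (u j.+1) w = (c j)%:R%:E])
         = (\prod_(j < q) poisson_prob (Lambda lam (u j) (u j.+1)) (c j))%:E)].

Definition batch_prob (n : nat) (mu : R -> probability R R) (F : R -> R -> R)
    (s : R) (k : nat) (x : nat -> R) : R :=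
  fine (mu s [set b | Num.ceil (n%:R * b) = k%:Z]) * \prod_(j < k) F s (x j).

(* The n-th batch infinite-server queue: batch i arrives at the point tau_i,
   has N_i customers, customer j < N_i of batch i brings work S_ij.
   Conditionally on the arrival process, the batches are independent, the size
   of a batch arriving at s is distributed as ceil(n B_s) and given the size the
   works are i.i.d. with CDF F_s.  This is stated on the pi-system of events
   {tau_i <= y_i, i < p} (restricted to the event that batches 0..r-1 exist). *)
Definition batch_queue (n : nat) (P : probability Omega R) (lam : R -> R)
    (mu : R -> probability R R) (F : R -> R -> R)
    (tau : nat -> Omega -> \bar R) (N : nat -> Omega -> nat)
    (S : nat -> nat -> Omega -> R) : Prop :=
  [/\ poisson_points P lam tau,
      (forall i k, measurable [set w | N i w = k]),
      (forall i j, measurable_fun setT (S i j)) &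
      (forall (r p : nat) (y : nat -> R) (k : nat -> nat) (x : nat -> nat -> R),
         let E := [set w | (forall i, (i < r)%N -> (tau i w < +oo)%E) /\
                           (forall i, (i < p)%N -> (tau i w <= (y i)%:E)%E)] in
         P (E `&` [set w | forall i, (i < r)%N ->
                      N i w = k i /\ (forall j, (j < k i)%N -> S i j w <= x i j)])
         = (\int[P]_(w in E)
              (\prod_(i < r) batch_prob n mu F (fine (tau i w)) (k i) (x i))%:E)%E)].

Definition queue_len (tau : nat -> Omega -> \bar R) (N : nat -> Omega -> nat)
    (S : nat -> nat -> Omega -> R) (t : R) (w : Omega) : R :=
  fine (\sum_(i <oo) (\sum_(j < N i w)
     (if (tau i w <= t%:E)%E && (t%:E < tau i w + (S i j w)%:E)%E then 1 else 0))%:E)%E.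

Definition departures (tau : nat -> Omega -> \bar R) (N : nat -> Omega -> nat)
    (S : nat -> nat -> Omega -> R) (t : R) (w : Omega) : R :=
  fine (\sum_(i <oo) (\sum_(j < N i w)
     (if (tau i w + (S i j w)%:E <= t%:E)%E then 1 else 0))%:E)%E.

End defs.

(* Main.v *)
Require Import Defs.
From HB Require Import structures.
From mathcomp Require Import all_boot all_order all_algebra.
From mathcomp Require Import all_classical all_reals all_analysis measurable_realfun.
From mathcomp Require Import ring lra.
Set Implicit Arguments. Unset Strict Implicit. Unset Printing Implicit Defensive.
Import Order.TTheory GRing.Theory Num.Theory.
Import numFieldNormedType.Exports.
Local Open Scope classical_set_scope.
Local Open Scope ring_scope.

(** Fix n and let H = t_m. The exponential is a product over the batches arriving
  in (0, H]; a customer arriving at s with work x contributes a factor e(s, x)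
  which depends on x only through the indicators of x <= t_k - s. As these are
  monotone in k, e(s, x) is an affine function of them ([psi]), so that its mean
  psi_n(s) is the same affine function of the numbers F_s(t_k - s). Hence, given
  the arrivals, a batch arriving at s contributes
  phi_n(s) = E_s[psi_n(s)^(ceil (n B_s))], and the Laplace functional of the
  Poisson process turns the expectation into exp(- int_0^H (1 - phi_n) lam).
  Since n (1 - psi_n(s)) tends to the rate appearing in the limit, phi_n(s)
  tends to its transform, and dominated convergence concludes.

  Expectations are computed from the product formulas of the hypotheses by
  closing the pairs (function, conditional expectation) under products, linear
  combinations and bounded limits ([pcl]). The Laplace functional is obtained
  first for step functions, from the Poisson counts, and then for measurable
  functions because all of them are iterated pointwise limits of step functions
  ([baire]). *)

(** * Pairs closed under linear combinations and limits *)

(** The conditional law is given only on boxes, where the sizes of the first r batches are fixed and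
    the works are bounded by constants. No conditional expectation is constructed: a pair records a
    function together with its intended conditional mean, and the closure rules keep the two in
    step. This is what forces the affine form [psi]: a product of two indicators of the same work
    has as conditional mean F_s at the smaller threshold, not a product of values of F_s. Products
    are therefore taken only across different customers or batches, or against functions of the
    arrival time. All functions are cut off to arrivals in (0, H], because [F s] is controlled only
    for s >= 0 and [fine] sends an absent point to 0. Negative works and infinitely many points in
    (0, H] are excluded only almost surely, and are discarded as null sets. *)

Section bounded_integral.
Context {R : realType} {d : measure_display} {T : measurableType d}.
Variable P : probability T R.
Implicit Types (f g h : T -> R).

Lemma bounded_integrable f (C : R) :
  measurable_fun setT f -> (forall w, `|f w| <= C) ->
  P.-integrable setT (EFin \o f).
Proof.
move=> mf fC; apply: measurable_bounded_integrable => //.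
  by rewrite [X in (X < _)%E]probability_setT ltry.
by exists C; split; [exact: num_real|move=> x Cx y _ /=; apply: le_trans (ltW Cx)].
Qed.

Lemma bounded_cvg_integral (h : nat -> T -> R) f (C : R) :
  (forall q, measurable_fun setT (h q)) -> measurable_fun setT f ->
  (forall q w, `|h q w| <= C) ->
  {ae P, forall w, (h ^~ w) @ \oo --> f w} ->
  (fun q => \int[P]_w (h q w)%:E)%E @ \oo --> (\int[P]_w (f w)%:E)%E.
Proof.
move=> mh mf hC hf.
have ic : P.-integrable setT (EFin \o cst C).
  by apply: (@bounded_integrable _ `|C|).
have mh' q : measurable_fun setT (EFin \o h q) by exact/measurable_EFinP.
have mf' : measurable_fun setT (EFin \o f) by exact/measurable_EFinP.
have hf' : {ae P, forall w, setT w ->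
    (fun q => (EFin \o h q) w) @ \oo --> (EFin \o f) w}.
  by apply: filterS hf => w hw _; apply: cvg_EFin => //; exact: nearW.
have hC' : {ae P, forall w q, setT w ->
    (`|(EFin \o h q) w| <= (EFin \o cst C) w)%E}.
  by apply: aeW => w q _ /=; rewrite lee_fin.
by have [] := @dominated_convergence _ _ _ P setT measurableT _ _ _
  mh' mf' hf' ic hC'.
Qed.

End bounded_integral.

Section pair_closure.
Context {R : realType} {T : Type}.
Implicit Types (h g : T -> R) (B : (T -> R) -> (T -> R) -> Prop).

(* Closure of a relation between functions under linear combinations and
   bounded pointwise limits, taken simultaneously on both components; a second
   component plays the role of a conditional expectation of the first one. *)
Inductive pcl B : (T -> R) -> (T -> R) -> Prop :=
| pcl_base h g : B h g -> pcl B h g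
| pcl_lin (a : R) h g h' g' : pcl B h g -> pcl B h' g' ->
    pcl B (fun w => a * h w + h' w) (fun w => a * g w + g' w)
| pcl_lim (C : R) (hs gs : nat -> T -> R) h g :
    (forall q, pcl B (hs q) (gs q)) ->
    (forall q w, `|hs q w| <= C) -> (forall q w, `|gs q w| <= C) ->
    (forall w, hs ^~ w @ \oo --> h w) -> (forall w, gs ^~ w @ \oo --> g w) ->
    pcl B h g.

Definition pbounded B := forall h g, B h g ->
  (exists C, forall w, `|h w| <= C) /\ (exists C, forall w, `|g w| <= C).

Lemma cvg_norm_le (u : nat -> R) (l C : R) :
  (forall q, `|u q| <= C) -> u @ \oo --> l -> `|l| <= C.
Proof.
move=> uC ul; have nul : `|u x| @[x --> \oo] --> `|l| by exact: cvg_norm.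
by rewrite -(cvg_lim _ nul)//; apply: limr_le; [exact: cvgP nul|exact: nearW].
Qed.

Lemma pcl_bounded B : pbounded B -> pbounded (pcl B).
Proof.
move=> bB h g; elim => {h g}.
- exact: bB.
- move=> a h g h' g' _ [[C1 hC1] [C2 hC2]] _ [[C3 hC3] [C4 hC4]].
  split; [exists (`|a| * C1 + C3)|exists (`|a| * C2 + C4)] => w;
    by apply: (le_trans (ler_normD _ _)); rewrite normrM lerD// ler_wpM2l.
- move=> C hs gs h g _ _ hC gC ch cg; split; exists C => w.
    exact: cvg_norm_le (ch w).
  exact: cvg_norm_le (cg w).
Qed.

(** Induction on the first pair, with an inner induction on the second when the first is a
    generator. At a limit the other factor stays fixed, and its boundedness gives the uniform bound
    that [pcl_lim] asks for; the maximum of two constants serves both components at once. *)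
Lemma pcl_mul B1 B2 B h g h' g' : pbounded B1 -> pbounded B2 ->
  (forall h g h' g', B1 h g -> B2 h' g' ->
     pcl B (fun w => h w * h' w) (fun w => g w * g' w)) ->
  pcl B1 h g -> pcl B2 h' g' ->
  pcl B (fun w => h w * h' w) (fun w => g w * g' w).
Proof.
move=> bB1 bB2 B12 B1hg B2hg.
have [[C1 hC1] [C2 hC2]] := pcl_bounded bB2 B2hg.
elim: B1hg => {h g}.
- move=> h g Bhg; elim: B2hg {C1 hC1 C2 hC2} => {h' g'}.
  + by move=> h' g'; exact: B12.
  + move=> a k l k' l' _ ih1 _ ih2.
    have := pcl_lin a ih1 ih2; congr (pcl B); apply/funext => w /=; ring.
  + move=> C hs gs k l _ ih hC gC ch cg.
    have [[C1 hC1] [C2 hC2]] := bB1 _ _ Bhg.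
    apply: (@pcl_lim _ (Num.max C1 C2 * C) _ _ _ _ ih).
    * by move=> q w; rewrite normrM ler_pM// le_max hC1.
    * by move=> q w; rewrite normrM ler_pM// le_max hC2 orbT.
    * by move=> w; apply: cvgM; [exact: cvg_cst|exact: ch].
    * by move=> w; apply: cvgM; [exact: cvg_cst|exact: cg].
- move=> a k l k' l' _ ih1 _ ih2.
  have := pcl_lin a ih1 ih2; congr (pcl B); apply/funext => w /=; ring.
- move=> C hs gs k l _ ih hC gC ch cg.
  apply: (@pcl_lim _ (C * Num.max C1 C2) _ _ _ _ ih).
  + by move=> q w; rewrite normrM ler_pM// le_max hC1.
  + by move=> q w; rewrite normrM ler_pM// le_max hC2 orbT.
  + by move=> w; apply: cvgM; [exact: ch|exact: cvg_cst].
  + by move=> w; apply: cvgM; [exact: cg|exact: cvg_cst].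
Qed.

(** One factor per index, each from its own family: independence hypotheses are product formulas of
    this shape. *)
Definition prod_pairs r (Bs : nat -> (T -> R) -> (T -> R) -> Prop) h g :=
  exists hs gs : nat -> T -> R, [/\ forall i, (i < r)%N -> Bs i (hs i) (gs i),
    h = (fun w => \prod_(i < r) hs i w) & g = (fun w => \prod_(i < r) gs i w)].

Lemma prod_pairs_bounded r Bs : (forall i, pbounded (Bs i)) ->
  pbounded (prod_pairs r Bs).
Proof.
move=> bB h g [hs] [gs] [Bhg -> ->].
elim: r Bhg => [|r ih] Bhg.
  by split; exists 1 => w; rewrite big_ord0 normr1.
have [|[C1 hC1] [C2 hC2]] := ih; first by move=> i ir; apply: Bhg; exact: ltnW.
have [[C3 hC3] [C4 hC4]] := bB r _ _ (Bhg r (ltnSn r)).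
by split; [exists (C1 * C3)|exists (C2 * C4)] => w;
  rewrite big_ord_recr/= normrM ler_pM.
Qed.

(** Reduces a product formula for limits to the one for generators, so that independence has to be
    checked only on the latter. *)
Lemma pcl_prod r Bs (u v : nat -> T -> R) : (forall i, pbounded (Bs i)) ->
  (forall i, (i < r)%N -> pcl (Bs i) (u i) (v i)) ->
  pcl (prod_pairs r Bs) (fun w => \prod_(i < r) u i w)
                        (fun w => \prod_(i < r) v i w).
Proof.
move=> bB; elim: r => [|r ih] uv.
  by apply: pcl_base; exists u, v; split => //.
have ur : pcl (prod_pairs r Bs) (fun w => \prod_(i < r) u i w)
                        (fun w => \prod_(i < r) v i w).
  by apply: ih => i ir; apply: uv; exact: ltnW.
have := pcl_mul (prod_pairs_bounded (r := r) bB) (bB r) (B := prod_pairs r.+1 Bs)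
  _ ur (uv r (ltnSn r)).
move=> /(_ _)/wrap[|].
  move=> h g h' g' [hs] [gs] [Bhg -> ->] Bhg'; apply: pcl_base.
  exists (fun i => if i == r then h' else hs i),
    (fun i => if i == r then g' else gs i); split.
  - move=> i; rewrite ltnS leq_eqVlt; case: eqP => [-> //|_ /=].
    exact: Bhg.
  - apply/funext => w; rewrite big_ord_recr/= eqxx; congr (_ * _).
    by apply: eq_bigr => i _; rewrite ltn_eqF.
  - apply/funext => w; rewrite big_ord_recr/= eqxx; congr (_ * _).
    by apply: eq_bigr => i _; rewrite ltn_eqF.
by congr (pcl _); apply/funext => w; rewrite big_ord_recr.
Qed.

(** The closure has no rule for constants, so 0 is obtained as -h + h from some generator. *)
Lemma pcl0 B h g : B h g -> pcl B (fun=> 0) (fun=> 0).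
Proof.
move=> /pcl_base Bhg; have := pcl_lin (-1) Bhg Bhg.
by congr (pcl B); apply/funext => w; rewrite mulN1r addNr.
Qed.

Lemma pcl_sum B (k : nat) (hs gs : nat -> T -> R) : (exists h g, B h g) ->
  (forall i, (i < k)%N -> pcl B (hs i) (gs i)) ->
  pcl B (fun w => \sum_(i < k) hs i w) (fun w => \sum_(i < k) gs i w).
Proof.
move=> [h [g Bhg]]; elim: k => [|k ih] hgs.
  have := pcl0 Bhg; congr (pcl B); apply/funext => w; by rewrite big_ord0.
have ur := ih (fun i ik => hgs i (ltnW ik)).
have := pcl_lin 1 ur (hgs k (ltnSn k)).
by congr (pcl B); apply/funext => w; rewrite big_ord_recr mul1r.
Qed.

Lemma pcl_scale B (a : R) h g : pcl B h g ->
  pcl B (fun w => a * h w) (fun w => a * g w).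
Proof.
move=> Bhg; have := pcl_lin (a - 1) Bhg Bhg.
by congr (pcl B); apply/funext => w; ring.
Qed.

Lemma pcl_sub B h g h' g' : pcl B h g -> pcl B h' g' ->
  pcl B (fun w => h w - h' w) (fun w => g w - g' w).
Proof.
move=> Bhg Bhg'; have := pcl_lin (-1) Bhg' Bhg.
by congr (pcl B); apply/funext => w; ring.
Qed.

End pair_closure.

(** Linearity and bounded convergence carry the equality of means from generators to the closure.
    Measurability belongs to the same induction because the limit step needs it. *)
Lemma pcl_integral {R : realType} {d} {T : measurableType d}
    (P : probability T R) (B : (T -> R) -> (T -> R) -> Prop) h g :
  pbounded B ->
  (forall h g, B h g -> measurable_fun setT h /\ measurable_fun setT g) ->
  (forall h g, B h g -> \int[P]_w (h w)%:E = \int[P]_w (g w)%:E)%E ->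
  pcl B h g ->
  [/\ measurable_fun setT h, measurable_fun setT g &
      (\int[P]_w (h w)%:E = \int[P]_w (g w)%:E)%E].
Proof.
move=> bB mB eB Bhg.
have ib u v : pcl B u v -> measurable_fun setT u -> measurable_fun setT v ->
    P.-integrable setT (EFin \o u) /\ P.-integrable setT (EFin \o v).
  move=> /(pcl_bounded bB) [[C1 hC1] [C2 hC2]] mu mv.
  by split; [apply: (@bounded_integrable _ _ _ _ _ C1)|
             apply: (@bounded_integrable _ _ _ _ _ C2)].
elim: Bhg => {h g}.
- by move=> h g Bhg; have [? ?] := mB _ _ Bhg; split => //; exact: eB.
- move=> a h g h' g' Bhg [mh mg ehg] Bhg' [mh' mg' ehg'].
  have [ih ig] := ib _ _ Bhg mh mg; have [ih' ig'] := ib _ _ Bhg' mh' mg'.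
  split.
  + by apply: measurable_funD => //; exact: measurable_funM.
  + by apply: measurable_funD => //; exact: measurable_funM.
  + under eq_integral do rewrite EFinD EFinM.
    under [RHS]eq_integral do rewrite EFinD EFinM.
    rewrite integralD//=; last exact: (integrableZl measurableT _ ih).
    rewrite integralD//=; last exact: (integrableZl measurableT _ ig).
    by rewrite !integralZl// ehg ehg'.
- move=> C hs gs h g Bhg ih hC gC ch cg.
  have mh : measurable_fun setT h.
    by apply: (@measurable_fun_cvg _ _ _ _ hs) => // q; case: (ih q).
  have mg : measurable_fun setT g.
    by apply: (@measurable_fun_cvg _ _ _ _ gs) => // q; case: (ih q).
  split => //.
  have c1 : (fun q => \int[P]_w (hs q w)%:E)%E @ \oo --> (\int[P]_w (h w)%:E)%E.
    apply: (@bounded_cvg_integral _ _ _ P hs h C) => //; last exact: aeW.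
    by move=> q; case: (ih q).
  have c2 : (fun q => \int[P]_w (gs q w)%:E)%E @ \oo --> (\int[P]_w (g w)%:E)%E.
    apply: (@bounded_cvg_integral _ _ _ P gs g C) => //; last exact: aeW.
    by move=> q; case: (ih q).
  rewrite -(cvg_lim _ c1)// -(cvg_lim _ c2)//; congr (lim (_ @ \oo)).
  by apply/funext => q; case: (ih q).
Qed.

(** * Customer factors and their conditional means *)

Section pick_sum.
Context {R : realType}.
Implicit Types (c : nat -> bool) (v : nat -> R).

(* v k for the only k such that c k, and 0 if there is none. *)
Definition pick_sum c v : R :=
  limn (fun K => \sum_(k < K) (c k)%:R * v k).

Lemma psum_one c v k K : (forall k k', c k -> c k' -> k = k') -> c k ->
  \sum_(i < K) (c i)%:R * v i = (k < K)%N%:R * v k.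
Proof.
move=> uc ck; case: (ltnP k K) => kK.
  rewrite (bigD1 (Ordinal kK))//= ck big1 ?addr0// => i.
  rewrite -val_eqE/= => ik; case ci : (c i); last by rewrite mul0r.
  by move: ik; rewrite (uc _ _ ci ck) eqxx.
rewrite mul0r big1// => i _; case ci : (c i); last by rewrite mul0r.
by have := ltn_ord i; rewrite (uc _ _ ci ck) ltnNge kK.
Qed.

Lemma psum_none c v K : (forall k, ~~ c k) -> \sum_(i < K) (c i)%:R * v i = 0.
Proof. by move=> nc; rewrite big1// => i _; rewrite (negbTE (nc i)) mul0r. Qed.

Lemma psum_bound c v (C : R) K : (forall k k', c k -> c k' -> k = k') ->
  0 <= C -> (forall k, c k -> `|v k| <= C) ->
  `|\sum_(i < K) (c i)%:R * v i| <= C.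
Proof.
move=> uc C0 vC; have [[k ck]|nc] := pselect (exists k, c k).
  rewrite (psum_one _ _ uc ck); case: ltnP => _; rewrite ?mul0r ?normr0//.
  by rewrite mul1r vC.
by rewrite psum_none ?normr0// => k; apply/negP => ck; apply: nc; exists k.
Qed.

Lemma psum_cvg c v k : (forall k k', c k -> c k' -> k = k') -> c k ->
  (fun K => \sum_(i < K) (c i)%:R * v i) @ \oo --> v k.
Proof.
move=> uc ck; apply: cvg_near_cst; exists k.+1 => // K /= kK.
by rewrite (psum_one _ _ uc ck) kK mul1r.
Qed.

Lemma pick_sumE c v k : (forall k k', c k -> c k' -> k = k') -> c k ->
  pick_sum c v = v k.
Proof. by move=> uc ck; apply: cvg_lim => //; exact: psum_cvg. Qed.

Lemma pick_sum0 c v : (forall k, ~~ c k) -> pick_sum c v = 0.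
Proof.
move=> nc; apply: cvg_lim => //; apply: cvg_near_cst; apply: nearW => K.
exact: psum_none.
Qed.

Lemma pick_sum_cvg c v : (forall k k', c k -> c k' -> k = k') ->
  (fun K => \sum_(i < K) (c i)%:R * v i) @ \oo --> pick_sum c v.
Proof.
move=> uc; have [[k ck]|nc] := pselect (exists k, c k).
  by rewrite (pick_sumE _ uc ck); exact: psum_cvg.
have nc' k : ~~ c k by apply/negP => ck; apply: nc; exists k.
rewrite pick_sum0//; apply: cvg_near_cst; apply: nearW => K.
exact: psum_none.
Qed.

End pick_sum.

(** * Distribution functions and the grid on (0, H] *)

Section cdf.
Context {R : realType}.
Implicit Types (F : R -> R).

Lemma cdf01 F x : is_cdf_nonneg F -> 0 <= F x <= 1.
Proof.
move=> [ndF _ F0 F1]; apply/andP; split.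
  have [x0|x0] := ltP x 0; first by rewrite F0.
  by rewrite -(F0 (-1)) ?ltrN10// ndF// (le_trans _ x0)// lerN10.
have cF := cvg_lim (@Rhausdorff R) F1; rewrite -cF.
apply: limr_ge; first by apply/cvg_ex; exists 1.
exists x; split; first exact: num_real.
by move=> y /ltW xy; exact: ndF.
Qed.

Lemma cdf_nat_cvg F : is_cdf_nonneg F -> F n%:R @[n --> \oo] --> (1 : R).
Proof. by move=> [_ _ _ F1]; exact: (cvg_comp _ _ cvgr_idn F1). Qed.

Lemma cdf_shift_cvg F x (u : nat -> R) (H : R) : 0 < H ->
  {homo F : x y / x <= y} -> F y @[y --> x^'+] --> F x ->
  (forall q, x < u q <= x + H / q.+1%:R) -> (F \o u) @ \oo --> F x.
Proof.
move=> H0 ndF cF xu; move/cvg_at_rightP : cF; apply; split.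
  by move=> q; case/andP: (xu q).
apply: (@squeeze_cvgr _ _ _ _ (cst x) (fun q => x + H / q.+1%:R)).
- by apply: nearW => q; case/andP: (xu q) => /ltW ->.
- exact: cvg_cst.
- rewrite -[X in _ --> X]addr0; apply: cvgD; first exact: cvg_cst.
  by rewrite -[X in _ --> X](mulr0 H); apply: cvgM; [exact: cvg_cst|exact: cvg_harmonic].
Qed.

(** Open on the left, so that the left endpoint u of the cell of s satisfies u < s strictly: then t
    - u lies strictly to the right of t - s, as right-continuity requires. *)
Definition cell (H : R) (q a : nat) (s : R) : bool :=
  (H * a%:R / q.+1%:R < s) && (s <= H * a.+1%:R / q.+1%:R).

Lemma cell_uniq (H : R) q s a a' : 0 < H -> cell H q a s -> cell H q a' s -> a = a'.
Proof.
move=> H0; wlog aa' : a a' / (a < a')%N.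
  move=> wl ca ca'; case: (ltngtP a a') => // aa'; first exact: wl.
  by apply/esym; exact: wl.
move=> /andP[_ sa] /andP[a's _]; have := lt_le_trans a's sa.
rewrite ltr_pM2r ?invr_gt0 ?ltr0n// ltr_pM2l// ltr_nat ltnS.
by rewrite leqNgt aa'.
Qed.

Lemma cell_exists (H : R) q s : 0 < s -> s <= H -> 
  exists a, (a < q.+1)%N /\ cell H q a s.
Proof.
move=> s0 sH.
have ex : exists a, s <= H * a.+1%:R / q.+1%:R.
  by exists q; rewrite -mulrA divff ?mulr1// pnatr_eq0.
case: (ex_minnP ex) => a sa mina; exists a; split.
  by rewrite ltnS; apply: mina; rewrite -mulrA divff ?mulr1// pnatr_eq0.
rewrite /cell sa andbT; case: a sa mina => [|a] sa mina.
  by rewrite mulr0 mul0r.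
by rewrite ltNge; apply/negP => /mina; rewrite ltnn.
Qed.

(** A single cell contains s, so the sum is F at one point, which lies to the right of t - s within
    H/(q+1). *)
Lemma cell_sum_cvg F (H s t : R) : 0 < s -> s <= H -> 
  {homo F : x y / x <= y} -> F y @[y --> (t - s)^'+] --> F (t - s) ->
  (fun q => \sum_(a < q.+1) (cell H q a s)%:R * F (t - H * a%:R / q.+1%:R))
    @ \oo --> F (t - s).
Proof.
move=> s0 sH ndF cF; have H0 : 0 < H by exact: lt_le_trans sH.
have /choice[u hu] : forall q, exists a, (a < q.+1)%N /\ cell H q a s.
  by move=> q; exact: cell_exists.
rewrite (_ : (fun q => _) = F \o (fun q => t - H * (u q)%:R / q.+1%:R)).
  apply: (@cdf_shift_cvg F (t - s) _ H) => // q.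
  have [uq /andP[us su]] := hu q; rewrite ltrD2l ltrN2 us/=.
  rewrite -addrA lerD2l lerNl opprD opprK lerBlDr -mulrDl.
  by rewrite -{2}(mulr1 H) -mulrDr natr1.
apply/funext => q /=; have [uq cu] := hu q.
rewrite (@psum_one _ (fun a => cell H q a s)
  (fun a => F (t - H * a%:R / q.+1%:R)) (u q)) ?uq ?mul1r//.
by move=> k k'; exact: cell_uniq.
Qed.

End cdf.

Section psi.
Context {R : realType}.
Implicit Types (a b th : nat -> R) (l : seq nat).

(* Expansion of \prod_(x <- l) (a x + (b x - a x) * th x) that is affine in th
   and agrees with the product when th is a nondecreasing 0/1 sequence. *)
Fixpoint psi a b th l : R :=
  if l is x :: l' then
    a x * psi a b th l' + th x * (b x - a x) * \prod_(z <- l') b z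
  else 1.

(** If the head indicator is 1, monotonicity makes all later ones 1, so the remaining product is
    that of the [b z] and the correction term replaces [a x] by [b x] exactly. *)
Lemma psi_bool a b (th : nat -> bool) l :
  pairwise (fun x z => th x ==> th z) l ->
  psi a b (fun x => (th x)%:R) l = \prod_(x <- l) (if th x then b x else a x).
Proof.
elim: l => [|x l ih] /=; first by rewrite big_nil.
move=> /andP[/allP xl /ih ->]; rewrite big_cons.
case: ifPn => thx; last by rewrite !mul0r addr0.
have -> : \prod_(z <- l) (if th z then b z else a z) = \prod_(z <- l) b z.
  by apply: eq_big_seq => z zl; have := xl _ zl; rewrite thx /= => ->.
rewrite (_ : true%:R = 1)//; ring.
Qed.

(** [psi] is the mean of the product when the indicators have means [th] and are coupled
    monotonically; this suggests the bounds, which are proved algebraically. *)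
Lemma psi_bounds a b th l :
  {in l, forall x, 0 <= a x <= 1} -> {in l, forall x, 0 <= b x <= 1} ->
  {in l, forall x, 0 <= th x <= 1} -> pairwise (fun x z => th x <= th z) l ->
  0 <= psi a b th l <= 1.
Proof.
move=> a01 b01 th01 pl.
(* [c] stands for the probability of an event on which all indicators are 1: there the product is
   that of the [b z], elsewhere it lies in [0, 1]. The induction hypothesis is used with [c] equal
   to [th x] at the head; the lemma is the case c = 0. *)
suff : forall c, 0 <= c <= 1 -> (forall x, x \in l -> c <= th x) ->
    c * \prod_(z <- l) b z <= psi a b th l <= 1 - c + c * \prod_(z <- l) b z.
  by move=> /(_ 0); rewrite !mul0r subr0 addr0 lexx ler01; apply=> // x xl;
    case/andP: (th01 x xl).
elim: l a01 b01 th01 pl => [_ _ _ _ c c01 _|x l ih a01 b01 th01 /= /andP[/allP xl pl] c c01 cl] /=.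
  by rewrite big_nil mulr1 subrK lexx andbT; case/andP: c01.
have xx : x \in x :: l by exact: mem_head.
have ll z : z \in l -> z \in x :: l by move=> zl; rewrite in_cons zl orbT.
have := ih (fun z zl => a01 z (ll z zl)) (fun z zl => b01 z (ll z zl))
  (fun z zl => th01 z (ll z zl)) pl _ (th01 x xx) xl; rewrite big_cons.
have : 0 <= \prod_(z <- l) b z <= 1.
  rewrite big_seq; apply: (big_ind (fun y => 0 <= y <= 1)).
  - by rewrite lexx ler01.
  - move=> y z /andP[y0 y1] /andP[z0 z1].
    by rewrite mulr_ge0//= mulr_ile1.
  - by move=> z /ll; exact: b01.
move: (\prod_(z <- l) b z) (psi a b th l) => B p.
move: (a01 x xx) (b01 x xx) (th01 x xx) (cl x xx) => {ih xl cl xx ll a01 b01 th01}.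
move: (a x) (b x) (th x) => ax bx t /andP[a0 a1] /andP[b0 b1] /andP[t0 t1] ct.
move=> /andP[B0 B1] /andP[p1 p2].
have bB0 : 0 <= bx * B by exact: mulr_ge0.
have bB1 : bx * B <= 1 by exact: mulr_ile1.
have h1 : 0 <= ax * (p - t * B) by rewrite mulr_ge0// subr_ge0.
have h2 : ax * (p - t * B) <= p - t * B by rewrite ler_piMl// subr_ge0.
have h3 : 0 <= (t - c) * (bx * B) by rewrite mulr_ge0// subr_ge0.
have h4 : 0 <= (t - c) * (1 - bx * B) by rewrite mulr_ge0// subr_ge0.
have -> : ax * p + t * (bx - ax) * B = ax * (p - t * B) + t * (bx * B) by ring.
by apply/andP; split; lra.
Qed.

End psi.

Section arrival_indicator.
Context {R : realType} {T : Type}.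
Implicit Types (tau : T -> \bar R).

(** Cutoff carried by the pairs below. Where it equals 1, [fine (tau w)] is a genuine positive
    arrival time. *)
Definition arr tau (y : R) (w : T) : R :=
  ((0%:E < tau w)%E && (tau w <= y%:E)%E)%:R.

Lemma arrP tau y w :
  (arr tau y w = 1 /\ exists s, [/\ tau w = s%:E, 0 < s & s <= y]) \/
  arr tau y w = 0.
Proof.
rewrite /arr; case: (tau w) => [s| |].
- case: (ltP 0 s) => s0; last by right; rewrite lte_fin ltNge s0.
  case: (leP s y) => sy; last by right; rewrite lee_fin leNgt sy andbF.
  by left; rewrite lte_fin lee_fin s0 sy; split => //; exists s.
- by right; rewrite leye_eq andbF.
- by right; rewrite ltNge leNye.
Qed.

Lemma arr1 tau y w s : tau w = s%:E -> 0 < s -> s <= y -> arr tau y w = 1.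
Proof. by move=> ts s0 sy; rewrite /arr ts lte_fin lee_fin s0 sy. Qed.

Lemma arr_norm tau y w : `|arr tau y w| <= 1.
Proof. by case: (arrP tau y w) => [[-> _]|->]; rewrite ?normr1 ?normr0. Qed.

Lemma arr_min tau y y' w :
  arr tau y w * arr tau y' w = arr tau (Num.min y y') w.
Proof.
rewrite /arr EFin_min le_min; case: (_ < _)%E; rewrite ?mul0r//=.
by case: (_ <= y%:E)%E; case: (_ <= y'%:E)%E; rewrite ?mul0r ?mul1r.
Qed.

(** Lying in a given cell is a difference of two cutoffs, hence a linear combination of generators.
    The bound on [a] keeps the right endpoint below H. *)
Lemma arr_cell tau (H : R) q a w : 0 < H -> (a < q.+1)%N ->
  arr tau (H * a.+1%:R / q.+1%:R) w - arr tau (H * a%:R / q.+1%:R) w =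
  arr tau H w * (cell H q a (fine (tau w)))%:R.
Proof.
move=> H0 aq; have q0 : 0 < q.+1%:R :> R by rewrite ltr0n.
have le1 : H * a%:R / q.+1%:R <= H * a.+1%:R / q.+1%:R.
  by rewrite ler_pM2r ?invr_gt0// ler_pM2l// ler_nat.
have le2 : H * a.+1%:R / q.+1%:R <= H.
  by rewrite ler_pdivrMr// ler_pM2l// ler_nat.
rewrite /arr /cell; case: (tau w) => [s| |]/=.
- rewrite !lte_fin !lee_fin; case: (ltP 0 s) => s0 /=; last by rewrite subr0 mul0r.
  have [sa|sa] := leP s (H * a.+1%:R / q.+1%:R).
    rewrite (le_trans sa le2)/= mul1r andbT ltNge.
    by case: (s <= _) => /=; rewrite ?subrr ?subr0.
  by rewrite andbF mulr0 leNgt (le_lt_trans le1 sa)/= subrr.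
- by rewrite !leye_eq/= !andbF subrr mul0r.
- by rewrite /= subrr mul0r.
Qed.

Lemma measurable_fun_bool_natr {d} {U : measurableType d} (b : U -> bool) :
  measurable_fun setT b -> measurable_fun setT (fun w => (b w)%:R : R).
Proof.
move=> mb; rewrite (_ : (fun w => _) = (fun w => if b w then 1 else 0)).
  by apply: measurable_fun_ifT => //; exact: measurable_cst.
by apply/funext => w; case: (b w).
Qed.

End arrival_indicator.

Lemma measurable_arr {R : realType} {d} {T : measurableType d}
  (tau : T -> \bar R) y : measurable_fun setT tau ->
  measurable_fun setT (arr tau y).
Proof.
move=> mt; apply: measurable_fun_bool_natr; apply: measurable_and.
  by apply: measurable_fun_lte => //; exact: measurable_cst.
by apply: measurable_fun_lee => //; exact: measurable_cst.
Qed.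

Lemma normr_bool_le1 {R : realType} (b : bool) : `|b%:R : R| <= 1.
Proof. by rewrite normr_nat; case: b. Qed.

(** * Pairs for one customer *)

Section service_pairs.
Context {R : realType} {T : Type}.
Variables (tau : T -> \bar R) (X : T -> R) (F : R -> R -> R) (H : R).
Hypothesis H0 : 0 < H.
Hypothesis cF : forall s, 0 <= s -> is_cdf_nonneg (F s).

Definition arr_pair (h g : T -> R) := exists y, h = arr tau y /\ g = arr tau y.

(** The threshold [x] is a constant, as in the events of [batch_queue]. *)
Definition service_pair (h g : T -> R) := exists y x : R,
  h = (fun w => arr tau y w * (X w <= x)%R%:R) /\
  g = (fun w => arr tau y w * F (fine (tau w)) x).

Lemma arr_pair_bounded : pbounded arr_pair.
Proof. by move=> h g [y [-> ->]]; split; exists 1; exact: arr_norm. Qed.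

Lemma service_pair_bounded : pbounded service_pair.
Proof.
move=> h g [y [x [-> ->]]]; split; exists 1 => w; case: (arrP tau y w).
- by move=> [-> _]; rewrite mul1r normr_bool_le1.
- by move=> ->; rewrite mul0r normr0.
- move=> [-> [s [-> /ltW s0 _]]]; rewrite mul1r/=.
  by case/andP: (cdf01 x (cF s0)) => ? ?; rewrite ger0_norm.
- by move=> ->; rewrite mul0r normr0.
Qed.

(** Functions of the arrival time may multiply a function of the work. Two functions of the same
    work may not be multiplied in this way, since their conditional means do not multiply. *)
Lemma arr_mul_service h g h' g' : pcl arr_pair h g -> pcl service_pair h' g' ->
  pcl service_pair (fun w => h w * h' w) (fun w => g w * g' w).
Proof.
apply: pcl_mul; [exact: arr_pair_bounded|exact: service_pair_bounded|].
move=> {}h {}g {}h' {}g' [y [-> ->]] [y' [x [-> ->]]]; apply: pcl_base.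
by exists (Num.min y y'), x; split; apply/funext => w; rewrite mulrA arr_min.
Qed.

Let ind_nd (r : R) : {homo (fun x => (r <= x)%R%:R : R) : x y / x <= y}.
Proof.
move=> x y xy; case: (leP r x) => rx; last by rewrite ler0n.
by rewrite (le_trans rx xy).
Qed.

Let ind_rc (r x : R) : ((r <= y)%R%:R : R) @[y --> x^'+] --> ((r <= x)%R%:R : R).
Proof.
apply: cvg_near_cst; case: (leP r x) => rx; near=> y.
  by rewrite (le_trans rx)//; apply: ltW; near: y; exact: nbhs_right_gt.
rewrite leNgt (_ : y < r)//; near: y; exact: nbhs_right_lt.
Unshelve. all: end_near. Qed.

(** A generator always constrains the work; the constraint is removed by letting its threshold tend
    to infinity, where [F] tends to 1. *)
Lemma pcl_service_one :
  pcl service_pair (arr tau H) (arr tau H).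
Proof.
apply: (@pcl_lim _ _ _ 1 (fun q w => arr tau H w * (X w <= q%:R)%R%:R)
   (fun q w => arr tau H w * F (fine (tau w)) q%:R)).
- by move=> q; apply: pcl_base; exists H, q%:R.
- move=> q w; rewrite normrM mulr_ile1 ?arr_norm//.
  exact: normr_bool_le1.
- move=> q w; case: (arrP tau H w) => [[-> [s [-> /ltW s0 _]]]|->].
    by rewrite mul1r/=; case/andP: (cdf01 q%:R (cF s0)) => ? ?; rewrite ger0_norm.
  by rewrite mul0r normr0.
- move=> w; rewrite -[X in _ --> X]mulr1; apply: cvgM; first exact: cvg_cst.
  apply: cvg_near_cst; near=> q; rewrite (_ : X w <= q%:R)//.
  by near: q; exact: nbhs_infty_ger.
- move=> w; case: (arrP tau H w) => [[-> [s [-> /ltW s0 _]]]|->].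
    rewrite -[X in _ --> X]mulr1; apply: cvgM; first exact: cvg_cst.
    exact/cdf_nat_cvg/cF.
  by under eq_fun do rewrite mul0r; exact: cvg_cst.
Unshelve. all: end_near. Qed.

(* The service threshold t - tau depends on the arrival time: it is approached
   from above by t - u with u the left endpoint of the grid cell containing tau. *)
Lemma pcl_service_shift (t : R) :
  pcl service_pair (fun w => arr tau H w * (X w <= t - fine (tau w))%R%:R)
    (fun w => arr tau H w * F (fine (tau w)) (t - fine (tau w))).
Proof.
(* [D] is either the indicator of [X w <= x] or [F] at the arrival time. Both are nondecreasing,
   right-continuous and [0, 1]-valued in x, so one argument treats the two components. *)
have key (D : T -> R -> R) : 
    (forall w s, tau w = s%:E -> 0 < s -> {homo D w : x y / x <= y} /\ 
       forall x, D w y @[y --> x^'+] --> D w x /\ 0 <= D w x <= 1) ->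
    (forall q w, `|arr tau H w * \sum_(a < q.+1) (cell H q a (fine (tau w)))%:R *
        D w (t - H * a%:R / q.+1%:R)| <= 1) /\
    (forall w, (fun q => arr tau H w * \sum_(a < q.+1) (cell H q a (fine (tau w)))%:R *
        D w (t - H * a%:R / q.+1%:R)) @ \oo --> arr tau H w * D w (t - fine (tau w))).
  move=> hD; split.
    move=> q w; case: (arrP tau H w) => [[-> [s [ts s0 sH]]]|->]; last first.
      by rewrite mul0r normr0.
    rewrite mul1r (@psum_bound _ (fun a => cell H q a (fine (tau w)))
      (fun a => D w (t - H * a%:R / q.+1%:R)))//.
    - by move=> k k'; exact: cell_uniq.
    - have [_ hw] := hD _ _ ts s0; move=> k _.
      by have [_ /andP[? ?]] := hw (t - H * k%:R / q.+1%:R); rewrite ger0_norm.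
  move=> w; case: (arrP tau H w) => [[-> [s [ts s0 sH]]]|->]; last first.
    by under eq_fun do rewrite mul0r; rewrite mul0r; exact: cvg_cst.
  apply: cvgM; first exact: cvg_cst.
  have [nd hw] := hD _ _ ts s0; rewrite ts/=; apply: cell_sum_cvg => //.
  by have [] := hw (t - s).
have [|b1 c1] := key (fun w x => (X w <= x)%R%:R).
  move=> w s _ _; split => // x; split; first exact: ind_rc.
  by case: (X w <= x); rewrite ?lexx ?ler01.
have [|b2 c2] := key (fun w x => F (fine (tau w)) x).
  move=> w s -> /ltW s0 /=; have cs := cF s0; case: (cs) => nd rc _ _.
  by split => // x; split; [exact: rc|exact: cdf01].
apply: (pcl_lim _ b1 b2 c1 c2) => q.
have := @pcl_sum _ _ service_pair q.+1
  (fun a w => (arr tau (H * a.+1%:R / q.+1%:R) w - arr tau (H * a%:R / q.+1%:R) w)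
     * (X w <= t - H * a%:R / q.+1%:R)%R%:R)
  (fun a w => (arr tau (H * a.+1%:R / q.+1%:R) w - arr tau (H * a%:R / q.+1%:R) w)
     * F (fine (tau w)) (t - H * a%:R / q.+1%:R)).
move=> /(_ _ _)/wrap[||].
- by do 2 eexists; exists 0, 0; split; reflexivity.
- move=> a aq.
  have p y : pcl service_pair (fun w => arr tau y w * (X w <= t - H * a%:R / q.+1%:R)%R%:R)
      (fun w => arr tau y w * F (fine (tau w)) (t - H * a%:R / q.+1%:R)).
    by apply: pcl_base; exists y, (t - H * a%:R / q.+1%:R).
  have := pcl_sub (p (H * a.+1%:R / q.+1%:R)) (p (H * a%:R / q.+1%:R)).
  by congr pcl; apply/funext => w; rewrite mulrBl.
by congr pcl; apply/funext => w; rewrite big_distrr/=; apply: eq_bigr => a _;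
  rewrite arr_cell// mulrA.
Qed.

(** The step is (c - 1) times the cutoff at min(H, t) plus the cutoff at H. *)
Lemma pcl_arr_step (t c : R) : pcl arr_pair
  (fun w => arr tau H w * (if fine (tau w) <= t then c else 1))
  (fun w => arr tau H w * (if fine (tau w) <= t then c else 1)).
Proof.
have p y : pcl arr_pair (arr tau y) (arr tau y) by apply: pcl_base; exists y.
have := pcl_lin (c - 1) (p (Num.min H t)) (p H).
have e w : (c - 1) * arr tau (Num.min H t) w + arr tau H w =
    arr tau H w * (if fine (tau w) <= t then c else 1).
  rewrite -arr_min; case: (arrP tau H w) => [[-> [s [ts s0 sH]]]|->]; last first.
    by rewrite !(mul0r, mulr0) addr0.
  rewrite ts/=; case: ifPn => st; first by rewrite (arr1 ts)//; ring.
  rewrite /arr ts lee_fin (negbTE st) andbF /=; ring.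
by congr pcl; apply/funext => w.
Qed.

(** Induction on [l]: each summand in the recursion of [psi] has exactly one factor that depends on
    the work, the others being constants or functions of the arrival time, so [arr_mul_service]
    suffices. *)
Lemma pcl_psi (A b t : nat -> R) (l : seq nat) : pcl service_pair
  (fun w => arr tau H w * psi (fun x => if fine (tau w) <= t x then A x else 1) b
              (fun x => (X w <= t x - fine (tau w))%R%:R) l)
  (fun w => arr tau H w * psi (fun x => if fine (tau w) <= t x then A x else 1) b
              (fun x => F (fine (tau w)) (t x - fine (tau w))) l).
Proof.
elim: l => [|x l ih] /=.
  have := pcl_service_one.
  by congr pcl; apply/funext => w; rewrite mulr1.
pose B := \prod_(z <- l) b z.
have p1 := arr_mul_service (pcl_arr_step (t x) (A x)) ih.
have p2 := arr_mul_service (pcl_lin (- B) (pcl_arr_step (t x) (A x))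
  (pcl_scale (b x * B) (pcl_base (ex_intro _ H (conj erefl erefl)))))
  (pcl_service_shift (t x)).
have := pcl_lin 1 p1 p2; congr pcl; apply/funext => w;
  rewrite -/B; case: (arrP tau H w) => [[-> _]|->]; ring.
Qed.

End service_pairs.

(** * Pairs for one batch *)

Section batch_pairs.
Context {R : realType} {T : Type}.
Variables (tau : T -> \bar R) (N : T -> nat) (S : nat -> T -> R).
Variables (F : R -> R -> R) (p : R -> nat -> R) (H : R).
Hypothesis cF : forall s, 0 <= s -> is_cdf_nonneg (F s).
Hypothesis p01 : forall s k, 0 <= p s k <= 1.

Definition batch_pair (h g : T -> R) := exists (y : R) (k : nat) (x : nat -> R),
  h = (fun w => arr tau y w * ((N w == k)%:R * \prod_(j < k) (S j w <= x j)%R%:R)) /\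
  g = (fun w => arr tau y w * (p (fine (tau w)) k * \prod_(j < k) F (fine (tau w)) (x j))).

Lemma prodr_norm_le1 (I : Type) (r : seq I) (f : I -> R) :
  (forall i, `|f i| <= 1) -> `|\prod_(i <- r) f i| <= 1.
Proof.
move=> f1; rewrite normr_prod; elim: r => [|i r ih]; rewrite ?big_nil//.
by rewrite big_cons mulr_ile1// prodr_ge0.
Qed.

Lemma batch_pair_bounded : pbounded batch_pair.
Proof.
move=> h g [y [k [x [-> ->]]]]; split; exists 1 => w; case: (arrP tau y w).
- move=> [-> _]; rewrite mul1r normrM mulr_ile1//.
    exact: normr_bool_le1.
  by apply: prodr_norm_le1 => j; exact: normr_bool_le1.
- by move=> ->; rewrite mul0r normr0.
- move=> [-> [s [-> /ltW s0 _]]]; rewrite mul1r/= normrM mulr_ile1//.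
    by case/andP: (p01 s k) => ? ?; rewrite ger0_norm.
  apply: prodr_norm_le1 => j.
  by case/andP: (cdf01 (x j) (cF s0)) => ? ?; rewrite ger0_norm.
- by move=> ->; rewrite mul0r normr0.
Qed.

(** The cutoff is idempotent; the copy outside the product keeps the identity valid for k = 0. *)
Lemma arr_mul_prod y k (u : nat -> T -> R) w :
  arr tau y w * \prod_(j < k) (arr tau y w * u j w) =
  arr tau y w * \prod_(j < k) u j w.
Proof.
case: (arrP tau y w) => [[-> _]|->]; last by rewrite !mul0r.
by rewrite !mul1r; apply: eq_bigr => j _; rewrite mul1r.
Qed.

Lemma pcl_batch_fixed k (e : nat -> T -> R) (f : R -> R) :
  (forall j, pcl (service_pair tau (S j) F) (fun w => arr tau H w * e j w)
                 (fun w => arr tau H w * f (fine (tau w)))) ->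
  pcl batch_pair (fun w => arr tau H w * ((N w == k)%:R * \prod_(j < k) e j w))
    (fun w => arr tau H w * (p (fine (tau w)) k * f (fine (tau w)) ^+ k)).
Proof.
move=> ef.
have pp := pcl_prod (r := k)
  (fun j => service_pair_bounded (tau := tau) (X := S j) cF)
  (fun j _ => ef j).
(* The indicator that the size is k gets its own one-element relation: it becomes a [batch_pair]
   only after multiplication by the k work indicators, because the hypothesis always bounds all
   works of a batch of prescribed size. *)
pose BN h g := h = (fun w => arr tau H w * (N w == k)%:R) /\
  g = (fun w => arr tau H w * p (fine (tau w)) k).
have bBN : pbounded BN.
  move=> h g [-> ->]; split; exists 1 => w; rewrite normrM mulr_ile1 ?arr_norm//.
    exact: normr_bool_le1.
  by case/andP: (p01 (fine (tau w)) k) => ? ?; rewrite ger0_norm.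
have pN : pcl BN (fun w => arr tau H w * (N w == k)%:R)
  (fun w => arr tau H w * p (fine (tau w)) k) by exact: pcl_base.
have := pcl_mul bBN (prod_pairs_bounded (r := k)
  (fun j => service_pair_bounded (tau := tau) (X := S j) cF)) (B := batch_pair)
  _ pN pp.
move=> /(_ _)/wrap[|].
  move=> _ _ h g [-> ->] [hs [gs [hgs -> ->]]]; apply: pcl_base.
  have /choice[yx hyx] : forall j, exists yx : R * R, (j < k)%N ->
      hs j = (fun w => arr tau yx.1 w * (S j w <= yx.2)%R%:R) /\
      gs j = (fun w => arr tau yx.1 w * F (fine (tau w)) yx.2).
    move=> j; case: (ltnP j k) => [jk|]; last by exists (0, 0).
    by have [y [x hgx]] := hgs _ jk; exists (y, x).
  (* The cutoffs of the k customers concern the same arrival, so they merge into one cutoff at the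
     minimum of their levels. *)
  have [y ey] : exists y, forall (u : nat -> T -> R) w,
      arr tau H w * \prod_(j < k) (arr tau (yx j).1 w * u j w) =
      arr tau y w * \prod_(j < k) u j w.
    elim: (k) => [|k' [y ih]]; first by exists H => u w; rewrite !big_ord0.
    exists (Num.min y (yx k').1) => u w.
    by rewrite !big_ord_recr/= mulrA ih -arr_min; ring.
  exists y, k, (fun j => (yx j).2); split; apply/funext => w.
    rewrite mulrAC -[RHS]mulrCA mulrC; congr (_ * _).
    rewrite -[RHS](ey (fun j w => (S j w <= (yx j).2)%R%:R)); congr (_ * _).
    by apply: eq_bigr => j _; have [->] := hyx j (ltn_ord j).
  rewrite mulrAC -[RHS]mulrCA mulrC; congr (_ * _).
  rewrite -[RHS](ey (fun j w => F (fine (tau w)) (yx j).2)); congr (_ * _).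
  by apply: eq_bigr => j _; have [_ ->] := hyx j (ltn_ord j).
congr pcl; apply/funext => w.
  rewrite mulrAC -[RHS]mulrCA mulrC; congr (_ * _).
  exact: (arr_mul_prod _ _ e).
rewrite mulrAC -[RHS]mulrCA mulrC; congr (_ * _).
rewrite (arr_mul_prod _ _ (fun j w => f (fine (tau w)))).
by rewrite prodr_const card_ord.
Qed.

(** Summation over the batch size, as a limit of finite sums. At most one term of the first sum is
    nonzero, and the second is bounded by assumption, so the limit is a bounded one. *)
Lemma pcl_batch (e : nat -> T -> R) (f phi : R -> R) :
  (forall j w, 0 <= e j w <= 1) ->
  (forall s, 0 < s -> s <= H -> 
     (fun K => \sum_(k < K) p s k * f s ^+ k) @ \oo --> phi s) ->
  (forall s K, 0 < s -> s <= H -> `|\sum_(k < K) p s k * f s ^+ k| <= 1) ->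
  (forall j, pcl (service_pair tau (S j) F) (fun w => arr tau H w * e j w)
                 (fun w => arr tau H w * f (fine (tau w)))) ->
  pcl batch_pair (fun w => arr tau H w * \prod_(j < N w) e j w)
    (fun w => arr tau H w * phi (fine (tau w))).
Proof.
move=> e01 fphi fb ef.
have ps K : pcl batch_pair
    (fun w => arr tau H w * \sum_(k < K) (N w == k)%:R * \prod_(j < k) e j w)
    (fun w => arr tau H w * \sum_(k < K) p (fine (tau w)) k * f (fine (tau w)) ^+ k).
  have := @pcl_sum _ _ batch_pair K _ _ _ (fun k _ => pcl_batch_fixed k ef).
  move=> /(_ _)/wrap[|].
    by do 2 eexists; exists 0, 0%N, (fun=> 0); split; reflexivity.
  by congr pcl; apply/funext => w; rewrite big_distrr.
have uN w : forall k k', N w == k -> N w == k' -> k = k'.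
  by move=> k k' /eqP <- /eqP.
apply: (pcl_lim (C := 1) ps).
- move=> K w; rewrite normrM mulr_ile1 ?arr_norm//.
  apply: (@psum_bound _ (fun k => N w == k) (fun k => \prod_(j < k) e j w)) => //.
    exact: uN.
  move=> k _; apply: prodr_norm_le1 => j.
  by case/andP: (e01 j w) => ? ?; rewrite ger0_norm.
- move=> K w; case: (arrP tau H w) => [[-> [s [-> s0 sH]]]|->].
    by rewrite mul1r/=; exact: fb.
  by rewrite mul0r normr0.
- move=> w; apply: cvgM; first exact: cvg_cst.
  apply: (@psum_cvg _ (fun k => N w == k) (fun k => \prod_(j < k) e j w)) => //.
  exact: uN.
- move=> w; case: (arrP tau H w) => [[-> [s [-> s0 sH]]]|->].
    by apply: cvgM; [exact: cvg_cst|exact: fphi].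
  by under eq_fun do rewrite mul0r; rewrite mul0r; exact: cvg_cst.
Qed.

End batch_pairs.

(** * Products over the arrivals in (0, H] *)

Section first_exit.
Context {R : realType} {T : Type}.
Variables (tau : nat -> T -> \bar R) (H : R).

Definition hit i w := ((0%:E < tau i w)%E && (tau i w <= H%:E)%E).

(* r is the least index of a point outside (0, H], so that run_prod multiplies
   over the points in (0, H] as soon as the points are positive and ordered; it
   is 0 when all points lie in (0, H]. *)
Definition exit_at w r := ~~ hit r w && all (hit^~ w) (iota 0 r).

Definition run_prod (f : nat -> T -> R) w : R :=
  pick_sum (exit_at w) (fun r => \prod_(i < r) f i w).

Lemma exit_at_hit w r i : exit_at w r -> (i < r)%N -> hit i w.
Proof. by move=> /andP[_ /allP h] ir; apply: h; rewrite mem_iota. Qed.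

Lemma exit_at_uniq w r r' : exit_at w r -> exit_at w r' -> r = r'.
Proof.
move=> er er'; case: (ltngtP r r') => // rr'.
  by move: er => /andP[/negP[]]; exact: exit_at_hit er' rr'.
by move: er' => /andP[/negP[]]; exact: exit_at_hit er rr'.
Qed.

Lemma run_prodE f w r : exit_at w r -> run_prod f w = \prod_(i < r) f i w.
Proof.
by move=> er; apply: (pick_sumE _ _ er) => k k'; exact: exit_at_uniq.
Qed.

(** Writes the exit event as a polynomial in the cutoffs, hence in generators. *)
Lemma exit_at_prod w r :
  (exit_at w r)%:R = (1 - arr (tau r) H w) * \prod_(i < r) arr (tau i) H w :> R.
Proof.
rewrite /exit_at -[arr (tau r) H w]/((hit r w)%:R).
rewrite -(big_mkord xpredT (fun i => arr (tau i) H w)).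
have -> : \prod_(0 <= i < r) arr (tau i) H w = (all (hit^~ w) (iota 0 r))%:R.
  rewrite /index_iota subn0; elim: (iota 0 r) => [|i s ih]; first by rewrite big_nil.
  rewrite big_cons ih/= -[arr _ _ _]/((hit i w)%:R).
  by case: (hit i w); rewrite ?mul1r ?mul0r.
by case: (hit r w); rewrite /= ?subrr ?mul0r ?subr0 ?mul1r.
Qed.

Lemma run_prod_partial_bound (f : nat -> T -> R) w K :
  (forall i, hit i w -> `|f i w| <= 1) ->
  `|\sum_(r < K) (exit_at w r)%:R * \prod_(i < r) f i w| <= 1.
Proof.
move=> f1; apply: (@psum_bound _ (exit_at w) (fun r => \prod_(i < r) f i w)) => //.
  by move=> k k'; exact: exit_at_uniq.
move=> r er; rewrite normr_prod.
suff : forall k, (k <= r)%N -> \prod_(i < k) `|f i w| <= 1 by exact.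
elim=> [|k ih] kr; first by rewrite big_ord0.
rewrite big_ord_recr/= mulr_ile1 ?prodr_ge0 ?ih 1?ltnW//.
by rewrite f1//; exact: exit_at_hit er kr.
Qed.

Lemma run_prod_cvg (f : nat -> T -> R) w :
  (fun K => \sum_(r < K) (exit_at w r)%:R * \prod_(i < r) f i w) @ \oo -->
    run_prod f w.
Proof.
by apply: (@pick_sum_cvg _ (exit_at w)) => k k'; exact: exit_at_uniq.
Qed.

Lemma run_prod_norm (f : nat -> T -> R) w : (forall i, hit i w -> `|f i w| <= 1) ->
  `|run_prod f w| <= 1.
Proof.
move=> f1; apply: (cvg_norm_le _ (@run_prod_cvg f w)) => K.
exact: run_prod_partial_bound.
Qed.

Variable Bs : nat -> (T -> R) -> (T -> R) -> Prop.
Hypothesis bBs : forall i, pbounded (Bs i).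

(* The optional factor arr (tau r) H is what is needed to express, by a
   difference, that the r-th point is not in (0, H]. *)
Definition run_pair (h g : T -> R) := exists (r : nat) (c : T -> R) h' g',
  [/\ c = (fun=> 1) \/ c = arr (tau r) H, prod_pairs r Bs h' g',
      h = (fun w => c w * h' w) & g = (fun w => c w * g' w)].

Lemma run_pair_bounded : pbounded run_pair.
Proof.
move=> h g [r [c [h' [g' [cE hg' -> ->]]]]].
have c1 w : `|c w| <= 1.
  by case: cE => ->; rewrite ?normr1//; exact: arr_norm.
have [[C1 hC1] [C2 hC2]] := prod_pairs_bounded bBs hg'.
split; [exists C1|exists C2] => w; rewrite normrM; apply: le_trans (_ : _ <= _).
- by apply: ler_wpM2r; [|exact: c1].
- by rewrite mul1r.
- by apply: ler_wpM2r; [|exact: c1].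
- by rewrite mul1r.
Qed.

(** For each r the exit indicator times the product is a difference of two closed pairs, with factor
    1 and with factor [arr (tau r) H]. Summing over r and passing to the limit is legitimate since
    at most one r is an exit. *)
Lemma pcl_run (h g : nat -> T -> R) :
  (forall i w, hit i w -> `|h i w| <= 1) ->
  (forall i w, hit i w -> `|g i w| <= 1) ->
  (forall i, pcl (Bs i) (fun w => arr (tau i) H w * h i w)
                        (fun w => arr (tau i) H w * g i w)) ->
  pcl run_pair (run_prod h) (run_prod g).
Proof.
move=> h1 g1 Bhg.
have step r : pcl run_pair
    (fun w => (exit_at w r)%:R * \prod_(i < r) h i w)
    (fun w => (exit_at w r)%:R * \prod_(i < r) g i w).
  have p := pcl_prod (r := r) bBs (fun i _ => Bhg i).
  pose c1 (u v : T -> R) := u = (fun=> 1) /\ v = (fun=> 1).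
  pose c2 (u v : T -> R) := u = arr (tau r) H /\ v = arr (tau r) H.
  have bc1 : pbounded c1.
    by move=> u v [-> ->]; split; exists 1 => w; rewrite normr1.
  have bc2 : pbounded c2.
    by move=> u v [-> ->]; split; exists 1 => w; exact: arr_norm.
  have p1 := pcl_mul bc1 (prod_pairs_bounded (r := r) bBs) (B := run_pair) _
    (pcl_base (conj erefl erefl)) p.
  have p2 := pcl_mul bc2 (prod_pairs_bounded (r := r) bBs) (B := run_pair) _
    (pcl_base (conj erefl erefl)) p.
  have := pcl_sub (p1 _) (p2 _); move=> /(_ _ _)/wrap[||].
  - move=> ? ? h' g' [-> ->] hg'; apply: pcl_base.
    by exists r, (fun=> 1), h', g'; split => //; left.
  - move=> ? ? h' g' [-> ->] hg'; apply: pcl_base.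
    by exists r, (arr (tau r) H), h', g'; split => //; right.
  congr pcl; apply/funext => w; rewrite exit_at_prod !big_split/=; ring.
have ps K : pcl run_pair
    (fun w => \sum_(r < K) (exit_at w r)%:R * \prod_(i < r) h i w)
    (fun w => \sum_(r < K) (exit_at w r)%:R * \prod_(i < r) g i w).
  apply: (@pcl_sum _ _ run_pair K
    (fun r w => (exit_at w r)%:R * \prod_(i < r) h i w)
    (fun r w => (exit_at w r)%:R * \prod_(i < r) g i w)) => [|i _]; last exact: step.
  do 2 eexists; exists 0%N, (fun=> 1), (fun=> 1), (fun=> 1); split => //; first by left.
  exists (fun _ _ => 0), (fun _ _ => 0).
  by split => //; apply/funext => w; rewrite big_ord0.
apply: (pcl_lim (C := 1) ps).
- by move=> K w; apply: run_prod_partial_bound => i; exact: h1.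
- by move=> K w; apply: run_prod_partial_bound => i; exact: g1.
- by move=> w; exact: run_prod_cvg.
- by move=> w; exact: run_prod_cvg.
Qed.

End first_exit.

Lemma ae_prob1 {R : realType} {d} {T : measurableType d} (P : probability T R)
  (A : set T) : measurable A -> P A = 1%E -> {ae P, forall w, A w}.
Proof.
move=> mA PA; exists (~` A); split; first exact: measurableC.
  by rewrite probability_setC// PA subee.
by move=> w.
Qed.

Lemma measurable_forall_lt {d} {T : measurableType d} r (Q : nat -> T -> Prop) :
  (forall i, measurable [set w | Q i w]) ->
  measurable [set w | forall i, (i < r)%N -> Q i w].
Proof.
move=> mQ; rewrite (_ : [set w | _] = \bigcap_(i in [set i | (i < r)%N]) [set w | Q i w]).
  by apply: bigcap_measurableType => // i _.
by apply/seteqP; split => w /= hw i /hw.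
Qed.

Lemma prod_bool {R : realType} r (b : nat -> bool) :
  \prod_(i < r) (b i)%:R = `[< forall i, (i < r)%N -> b i >]%:R :> R.
Proof.
have [hb|hb] := pselect (forall i, (i < r)%N -> b i).
  by rewrite asboolT// big1// => i _; rewrite hb.
rewrite asboolF//; apply/eqP; rewrite prodf_seq_eq0; apply: contra_notT hb.
move=> /hasPn hb i ir; have := hb (Ordinal ir) (mem_index_enum _).
by rewrite /= pnatr_eq0 eqb0 negbK.
Qed.

Lemma points_pos_ae {R : realType} {d} {T : measurableType d}
    (P : probability T R) (lam : R -> R) (tau : nat -> T -> \bar R) :
  poisson_points P lam tau -> {ae P, forall w, forall i, (0%:E < tau i w)%E}.
Proof.
move=> [mtau _ pos _]; apply: ae_prob1 pos.
rewrite (_ : [set w | _] = \bigcap_i [set w | (0%:E < tau i w)%E]).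
  apply: bigcapT_measurable => i; rewrite -[X in measurable X]setTI.
  by apply: measurable_lte => //; exact: measurable_cst.
by apply/seteqP; split => w hw i; [move=> _; exact: (hw i)|exact: (hw i I)].
Qed.

(** * Equality of integrals on the generators of the queue *)

Section queue_pairs.
Context {R : realType} {d : measure_display} {T : measurableType d}.
Variables (n : nat) (P : probability T R) (lam : R -> R).
Variables (mu : R -> probability R R) (F : R -> R -> R).
Variables (tau : nat -> T -> \bar R) (N : nat -> T -> nat).
Variables (S : nat -> nat -> T -> R) (H : R).
Hypothesis mmu : forall A, measurable A -> measurable_fun setT (fun s => mu s A).
Hypothesis mF : measurable_fun setT (fun p : R * R => F p.1 p.2).
Hypothesis bq : batch_queue n P lam mu F tau N S.

Definition size_prob (s : R) (k : nat) : R :=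
  fine (mu s [set b | Num.ceil (n%:R * b) = k%:Z]).

Lemma measurable_ceil_eq k : measurable [set b : R | Num.ceil (n%:R * b) = k%:Z].
Proof.
rewrite (_ : [set b | _] = (fun b : R => n%:R * b) @^-1` [set` `]k%:R - 1, k%:R]]).
  have mf : measurable_fun setT (fun b : R => n%:R * b) by exact: measurable_funM.
  by rewrite -[X in measurable X]setTI; exact: mf.
apply/seteqP; split => b /=; rewrite in_itv/=.
  by move=> bk; move: (ceil_itv (n%:R * b)); rewrite bk intrB.
by move=> bk; apply: ceil_def; rewrite intrB.
Qed.

Lemma size_prob01 s k : 0 <= size_prob s k <= 1.
Proof.
rewrite /size_prob fine_ge0//=.
by rewrite -lee_fin fineK ?fin_num_measure// ?probability_le1//; exact: measurable_ceil_eq.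
Qed.

Lemma measurable_size_prob k : measurable_fun setT (size_prob ^~ k).
Proof.
apply: (measurableT_comp (fine_measurable measurableT)).
exact: mmu (measurable_ceil_eq k).
Qed.

Let bpair i := batch_pair (tau i) (N i) (S i) F size_prob.

Let pp : poisson_points P lam tau.
Proof. by case: bq. Qed.

Let mtau i : measurable_fun setT (tau i).
Proof. by case: bq => -[]. Qed.

Let mftau i : measurable_fun setT (fun w => fine (tau i w)).
Proof. exact: (measurableT_comp (fine_measurable measurableT)). Qed.

Lemma measurable_F_arrival i x : measurable_fun setT (fun w => F (fine (tau i w)) x).
Proof.
have mp : measurable_fun setT (fun w => (fine (tau i w), x)).
  exact: measurable_fun_pair.
exact: (measurableT_comp mF mp).
Qed.

Lemma measurable_batch_pair i h g : bpair i h g ->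
  measurable_fun setT h /\ measurable_fun setT g.
Proof.
case: bq => _ mN mS _ [y [k [x [-> ->]]]]; split.
  apply: measurable_funM; first exact: measurable_arr.
  apply: measurable_funM.
    apply: measurable_fun_bool_natr.
    apply: (measurable_fun_bool true); rewrite setTI.
    rewrite (_ : _ @^-1` _ = [set w | N i w = k])//.
    by apply/seteqP; split => w /= /eqP.
  apply: measurable_prod => j _; apply: measurable_fun_bool_natr.
  by apply: measurable_fun_ler => //; exact: measurable_cst.
apply: measurable_funM; first exact: measurable_arr.
apply: measurable_funM.
  exact: measurableT_comp (@measurable_size_prob k) _.
by apply: measurable_prod => j _; exact: measurable_F_arrival.
Qed.

Lemma measurable_run_pair h g : run_pair tau H bpair h g ->
  measurable_fun setT h /\ measurable_fun setT g.
Proof.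
move=> [r [c [h' [g' [cE [hs [gs [hgs -> ->]]] -> ->]]]]].
have mc : measurable_fun setT c.
  by case: cE => ->; [exact: measurable_cst|exact: measurable_arr].
split; apply: measurable_funM => //; apply: measurable_prod => i _.
  by have [] := measurable_batch_pair (hgs i (ltn_ord i)).
by have [] := measurable_batch_pair (hgs i (ltn_ord i)).
Qed.

(** The two integrals are the two sides of the conditional-law clause of [batch_queue], once the
    cutoffs are replaced by the events [tau i w <= y i], which agree with them when all points are
    positive. *)
Lemma run_pair_integral h g : run_pair tau H bpair h g ->
  (\int[P]_w (h w)%:E = \int[P]_w (g w)%:E)%E.
Proof.
move=> hg; have [mh mg] := measurable_run_pair hg.
case: bq => _ mN mS hP.
move: hg mh mg => [r [c [h' [g' [cE [hs [gs [hgs -> ->]]] -> ->]]]]] mh mg.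
have /choice[ykx hykx] : forall i, exists ykx : R * nat * (nat -> R), (i < r)%N ->
    hs i = (fun w => arr (tau i) ykx.1.1 w *
      ((N i w == ykx.1.2)%:R * \prod_(j < ykx.1.2) (S i j w <= ykx.2 j)%R%:R)) /\
    gs i = (fun w => arr (tau i) ykx.1.1 w *
      (size_prob (fine (tau i w)) ykx.1.2 *
       \prod_(j < ykx.1.2) F (fine (tau i w)) (ykx.2 j))).
  move=> i; case: (ltnP i r) => [ir|]; last by exists (0, 0%N, fun=> 0).
  by have [y [k [x ?]]] := hgs i ir; exists (y, k, x).
pose k i := (ykx i).1.2; pose x i := (ykx i).2.
pose y i := if i == r then H else (ykx i).1.1.
have yr i : (i < r)%N -> y i = (ykx i).1.1 by move=> ir; rewrite /y ltn_eqF.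
(* p is r, or r + 1 when the factor [arr (tau r) H] is present: the arrival event then bounds one
   more point than there are prescribed batches, with bound [y r] equal to H. *)
have [p [rp cp]] : exists p, (r <= p)%N /\ forall w,
    c w * \prod_(i < r) arr (tau i) (ykx i).1.1 w = \prod_(i < p) arr (tau i) (y i) w.
  case: cE => ->; [exists r|exists r.+1]; split => // w.
    by rewrite mul1r; apply: eq_bigr => i _; rewrite yr.
  rewrite big_ord_recr/= {2}/y eqxx mulrC; congr (_ * _).
  by apply: eq_bigr => i _; rewrite yr.
pose E := [set w | (forall i, (i < r)%N -> (tau i w < +oo)%E) /\
                   (forall i, (i < p)%N -> (tau i w <= (y i)%:E)%E)].
pose A := [set w | forall i, (i < r)%N ->
  N i w = k i /\ (forall j, (j < k i)%N -> S i j w <= x i j)].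
have mE : measurable E.
  apply: measurableI; apply: measurable_forall_lt => i;
    rewrite -[X in measurable X]setTI.
    by apply: measurable_lte => //; exact: measurable_cst.
  by apply: measurable_lee => //; exact: measurable_cst.
have mA : measurable A.
  apply: measurable_forall_lt => i; apply: measurableI; first exact: mN.
  apply: measurable_forall_lt => j; rewrite -[X in measurable X]setTI.
  by apply: measurable_fun_le => //; exact: measurable_cst.
have Eind w : (forall i, (0%:E < tau i w)%E) ->
    \prod_(i < p) arr (tau i) (y i) w = \1_E w.
  move=> pos; rewrite (eq_bigr (fun i : 'I_p => (tau i w <= (y i)%:E)%E%:R)).
    rewrite (prod_bool p (fun i => (tau i w <= (y i)%:E)%E)) indicE.
    congr (_ : bool)%:R; apply/asboolP/idP.
      move=> hw; apply/mem_set; split => // i ir.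
      by apply: le_lt_trans (ltry (y i)); apply: hw; exact: leq_trans rp.
    by move=> /set_mem[].
  by move=> i _; rewrite /arr pos.
have Aind w : \prod_(i < r) ((N i w == k i)%:R *
    \prod_(j < k i) (S i j w <= x i j)%R%:R) = \1_A w :> R.
  rewrite (eq_bigr (fun i : 'I_r => ((N i w == k i) &&
     `[< forall j, (j < k i)%N -> S i j w <= x i j >])%:R)); last first.
    move=> i _; rewrite (prod_bool (k i) (fun j => S i j w <= x i j)).
    by case: (_ == _); rewrite ?mul0r ?mul1r.
  rewrite (prod_bool r (fun i => (N i w == k i) &&
     `[< forall j, (j < k i)%N -> S i j w <= x i j >])) indicE.
  congr (_ : bool)%:R; apply/asboolP/idP.
    by move=> hw; apply/mem_set => i /hw /andP[/eqP ? /asboolP].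
  by move=> /set_mem hw i /hw[-> /asboolP ->]; rewrite eqxx.
have hE w : (forall i, (0%:E < tau i w)%E) ->
    c w * \prod_(i < r) hs i w = \1_(E `&` A) w.
  move=> pos; rewrite indicI/= -Aind -Eind// -cp -mulrA; congr (_ * _).
  by rewrite -big_split; apply: eq_bigr => i _; have [-> _] := hykx i (ltn_ord i).
have gE w : (forall i, (0%:E < tau i w)%E) ->
    c w * \prod_(i < r) gs i w = \1_E w *
      \prod_(i < r) batch_prob n mu F (fine (tau i w)) (k i) (x i).
  move=> pos; rewrite -Eind// -cp -mulrA; congr (_ * _).
  by rewrite -big_split; apply: eq_bigr => i _; have [_ ->] := hykx i (ltn_ord i).
transitivity (\int[P]_w (\1_(E `&` A) w)%:E)%E.
  apply: ae_eq_integral => //.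
  - exact/measurable_EFinP.
  - by apply/measurable_EFinP; apply: measurable_indic; exact: measurableI.
  - by apply: filterS (points_pos_ae pp) => w pos _; rewrite hE.
rewrite integral_indic//; last exact: measurableI.
rewrite setIT [LHS](hP r p y k x) integral_mkcond; apply: ae_eq_integral => //.
- rewrite -/E (_ : _ \_ _ = fun w => (\1_E w *
      \prod_(i < r) batch_prob n mu F (fine (tau i w)) (k i) (x i))%:E); last first.
    apply/funext => w; rewrite patchE indicE; case: (w \in E) => //=.
      by rewrite mul1r.
    by rewrite mul0r.
  apply/measurable_EFinP; apply: measurable_funM; first exact: measurable_indic.
  apply: measurable_prod => i _; apply: measurable_funM.
    exact: measurableT_comp (@measurable_size_prob (k i)) _.
  by apply: measurable_prod => j _; exact: measurable_F_arrival.
- exact/measurable_EFinP.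
- apply: filterS (points_pos_ae pp) => w pos _; rewrite gE// -/E patchE indicE.
  by case: (w \in E); rewrite ?mul1r ?mul0r.
Qed.

End queue_pairs.

Lemma nondecreasing_on {R : realType} (u : nat -> R) q :
  (forall j, (j < q)%N -> u j < u j.+1) ->
  forall i j, (i <= j <= q)%N -> u i <= u j.
Proof.
move=> uu i j /andP[+ jq]; elim: j jq => [|j ih] jq.
  by rewrite leqn0 => /eqP ->.
rewrite leq_eqVlt => /orP[/eqP -> //|ij].
by apply: (le_trans (ih (ltnW jq) ij)); apply: ltW; exact: uu.
Qed.

Lemma integral_partition {R : realType} (u : nat -> R) q (f : R -> \bar R) :
  (forall j, (j < q)%N -> u j < u j.+1) ->
  measurable_fun `]u 0%N, u q] f -> (forall x, (0 <= f x)%E) ->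
  (\int[lebesgue_measure]_(x in `]u 0%N, u q]) f x =
   \sum_(j < q) \int[lebesgue_measure]_(x in `]u j, u j.+1]) f x)%E.
Proof.
move=> uu mf f0; have und := nondecreasing_on uu.
suff h : forall k, (k <= q)%N ->
  (\int[lebesgue_measure]_(x in `]u 0%N, u k]) f x =
   \sum_(j < k) \int[lebesgue_measure]_(x in `]u j, u j.+1]) f x)%E by exact: h.
elim=> [_|k ih kq].
  by rewrite set_itvoc0 integral_set0 big_ord0.
have u0k : u 0%N <= u k by apply: und; rewrite leq0n/= ltnW.
have ukk : u k <= u k.+1 by exact/ltW/uu.
have ukq : u k.+1 <= u q by apply: und; rewrite kq leqnn.
rewrite (@itv_bndbnd_setU _ _ _ (BRight (u k))) ?bnd_simp//.
rewrite ge0_integral_setU//=; first last.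
- apply/disj_setPS => x [] /=; rewrite !in_itv/= => /andP[_ xu] /andP[ux _].
  by move: xu; rewrite leNgt ux.
- rewrite -itv_bndbnd_setU ?bnd_simp//.
  by apply: measurable_funS mf => //; apply: subset_itvl; rewrite bnd_simp.
by rewrite (ih (ltnW kq)) big_ord_recr.
Qed.

(** * Laplace functional of the Poisson process *)

Section poisson_series.
Context {R : realType}.
Implicit Types (L z : R).

Lemma poisson_gf_cvg L z :
  (fun K => \sum_(k < K) z ^+ k * Defs.poisson_prob L k) @ \oo -->
  expR (- (L * (1 - z))).
Proof.
have -> : - (L * (1 - z)) = - L + L * z by ring.
rewrite expRD.
rewrite (_ : (fun K => _) = (fun K => expR (- L) * series (exp_coeff (L * z)) K)).
  by apply: cvgM; [exact: cvg_cst|exact: is_cvg_series_exp_coeff].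
apply/funext => K; rewrite /series/= big_mkord big_distrr/=.
by apply: eq_bigr => k _; rewrite /Defs.poisson_prob /exp_coeff/= exprMn; ring.
Qed.

(** The partial sums increase to exp(- L (1 - z)), which is at most 1. *)
Lemma poisson_gf_bound L z K : 0 <= L -> 0 <= z <= 1 ->
  `|\sum_(k < K) z ^+ k * Defs.poisson_prob L k| <= 1.
Proof.
move=> L0 /andP[z0 z1].
have p0 k : 0 <= Defs.poisson_prob L k.
  by rewrite /Defs.poisson_prob mulr_ge0// mulr_ge0 ?expR_ge0 ?exprn_ge0.
rewrite ger0_norm ?sumr_ge0//; last by move=> k _; rewrite mulr_ge0 ?exprn_ge0.
apply: (@le_trans _ _ (expR (- (L * (1 - z))))); last first.
  by rewrite -[leRHS]expR0 ler_expR lerNl oppr0 mulr_ge0// subr_ge0.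
have c := @poisson_gf_cvg L z; rewrite -(cvg_lim _ c)//.
apply: (@nondecreasing_cvgn_le _ (fun K => \sum_(k < K) z ^+ k * Defs.poisson_prob L k)).
  apply/nondecreasing_seqP => n; rewrite big_ord_recr/= lerDl.
  by rewrite mulr_ge0 ?exprn_ge0.
by apply/cvg_ex; exists (expR (- (L * (1 - z)))).
Qed.

End poisson_series.

Section poisson_counts.
Context {R : realType} {d : measure_display} {T : measurableType d}.
Variables (P : probability T R) (lam : R -> R) (tau : nat -> T -> \bar R).
Hypothesis lam0 : forall x, 0 <= lam x.
Hypothesis pp : poisson_points P lam tau.

Lemma Lambda_ge0 s t : 0 <= Lambda lam s t.
Proof. by rewrite fine_ge0// integral_ge0// => x _; rewrite lee_fin. Qed.

Lemma measurable_count_in s t : measurable_fun setT (count_in tau s t).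
Proof.
case: pp => mtau _ _ _; apply: ge0_emeasurable_sum.
  by move=> k x _ _; rewrite lee_fin; case: ifP.
move=> k _; apply/measurable_EFinP.
apply: (@measurable_fun_ifT) => //; apply: measurable_and.
  by apply: measurable_fun_lte => //; exact: measurable_cst.
by apply: measurable_fun_lee => //; exact: measurable_cst.
Qed.

Definition count_is s t w k : bool := count_in tau s t w == k%:R%:E.

Lemma count_is_uniq s t w k k' : count_is s t w k -> count_is s t w k' -> k = k'.
Proof.
by rewrite /count_is => /eqP -> /eqP -[] /eqP; rewrite eqr_nat => /eqP.
Qed.

Lemma measurable_count_is s t k : measurable [set w | count_is s t w k].
Proof.
rewrite (_ : [set w | _] = count_in tau s t @^-1` [set k%:R%:E]).
  by rewrite -[X in measurable X]setTI; apply: measurable_count_in.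
by apply/seteqP; split => w /= /eqP.
Qed.

(** z to the power of the number of points in (s, t], and 0 when there are infinitely many. *)
Definition count_pow s t (z : R) w : R :=
  pick_sum (count_is s t w) (fun k => z ^+ k).

(** The same closure of pairs, with constants as second components: the generators are count
    indicators paired with Poisson probabilities, and their product formula is the independence of
    the counts. *)
Lemma poisson_pgf q (u z : nat -> R) :
  0 <= u 0%N -> (forall j, (j < q)%N -> u j < u j.+1) ->
  (forall j, 0 <= z j <= 1) ->
  measurable_fun setT (fun w => \prod_(j < q) count_pow (u j) (u j.+1) (z j) w) /\
  (\int[P]_w (\prod_(j < q) count_pow (u j) (u j.+1) (z j) w)%:E =
   (\prod_(j < q) expR (- (Lambda lam (u j) (u j.+1) * (1 - z j))))%:E)%E.
Proof.
move=> u0 uu z01.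
pose L j := Lambda lam (u j) (u j.+1).
pose Bs j (h g : T -> R) := exists k,
  h = (fun w => (count_is (u j) (u j.+1) w k)%:R) /\ g = (fun=> Defs.poisson_prob (L j) k).
have bBs j : pbounded (Bs j).
  move=> h g [k [-> ->]]; split; first by exists 1 => w; exact: normr_bool_le1.
  by exists `|Defs.poisson_prob (L j) k|.
have pj j : pcl (Bs j) (count_pow (u j) (u j.+1) (z j))
                       (fun=> expR (- (L j * (1 - z j)))).
  have zk k : `|z j ^+ k| <= 1.
    have /andP[z0 z1] := z01 j.
    by rewrite ger0_norm ?exprn_ge0// exprn_ile1.
  apply: (@pcl_lim _ _ _ 1
    (fun K w => \sum_(k < K) (count_is (u j) (u j.+1) w k)%:R * z j ^+ k)
    (fun K w => \sum_(k < K) z j ^+ k * Defs.poisson_prob (L j) k)).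
  - move=> K; have := @pcl_sum _ _ (Bs j) K
      (fun k w => z j ^+ k * (count_is (u j) (u j.+1) w k)%:R)
      (fun k w => z j ^+ k * Defs.poisson_prob (L j) k).
    move=> /(_ _ _)/wrap[||].
    + by do 2 eexists; exists 0%N; split; reflexivity.
    + by move=> k _; apply: pcl_scale; apply: pcl_base; exists k.
    by congr pcl; apply/funext => w; apply: eq_bigr => k _; rewrite mulrC.
  - move=> K w; apply: (@psum_bound _ (count_is (u j) (u j.+1) w) (fun k => z j ^+ k)) => //.
    by move=> k k'; exact: count_is_uniq.
  - by move=> K w; apply: poisson_gf_bound => //; exact: Lambda_ge0.
  - move=> w; apply: (@pick_sum_cvg _ (count_is (u j) (u j.+1) w)).
    by move=> k k'; exact: count_is_uniq.
  - by move=> w; exact: poisson_gf_cvg.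
have [] := pcl_integral (P := P) (prod_pairs_bounded bBs) _ _
    (pcl_prod (r := q) bBs (fun j _ => pj j)); last first.
- move=> m1 _ ->; split => //.
  by rewrite integral_cst//= probability_setT mule1.
- move=> h g [hs [gs [hgs -> ->]]].
  have /choice[k hk] : forall j, exists k, (j < q)%N ->
      hs j = (fun w => (count_is (u j) (u j.+1) w k)%:R) /\
      gs j = (fun=> Defs.poisson_prob (L j) k).
    move=> j; case: (ltnP j q) => [jq|_]; last by exists 0%N.
    by have [k ?] := hgs j jq; exists k.
  case: pp => _ _ _ /(_ q u k u0 uu) hP.
  transitivity (\prod_(j < q) Defs.poisson_prob (L j) (k j))%:E; last first.
    apply/esym; rewrite -[RHS]mule1 -(probability_setT P) -integral_cst//.
    apply: eq_integral => w _; congr (_%:E); apply: eq_bigr => j _.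
    by have [_ ->] := hk j (ltn_ord j).
  rewrite -hP; set A := (X in P X).
  have mA : measurable A.
    apply: bigcap_measurableType => // j _.
    have := measurable_count_is (u j) (u j.+1) (k j); congr measurable.
    by apply/seteqP; split => w /= /eqP.
  rewrite -[A]setIT -integral_indic//; apply: eq_integral => w _; congr (_%:E).
  rewrite (eq_bigr (fun j : 'I_q => (count_is (u j) (u j.+1) w (k j))%:R)).
    rewrite (prod_bool q (fun j => count_is (u j) (u j.+1) w (k j))) indicE.
    congr (_ : bool)%:R; apply/asboolP/idP.
      by move=> hw; apply/mem_set => j /= /hw /eqP.
    by move=> /set_mem hw j jq; apply/eqP; exact: hw.
  by move=> j _; have [-> _] := hk j (ltn_ord j).
- move=> h g [hs [gs [hgs -> ->]]]; split; apply: measurable_prod => j _.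
    have [k [-> _]] := hgs j (ltn_ord j); apply: measurable_fun_bool_natr.
    apply: (measurable_fun_bool true); rewrite setTI.
    have := measurable_count_is (u j) (u j.+1) k. exact.
  have [k [_ ->]] := hgs j (ltn_ord j); exact: measurable_cst.
Qed.

Variable H : R.
Hypothesis H0 : 0 < H.

Let tpos w := forall i, (0%:E < tau i w)%E.

Lemma tau_nd i j w : (i <= j)%N -> (tau i w <= tau j w)%E.
Proof.
case: pp => _ nd _ _; elim: j => [|j ih]; first by rewrite leqn0 => /eqP ->.
by rewrite leq_eqVlt => /orP[/eqP -> //|ij]; exact: le_trans (ih ij) (nd j w).
Qed.

Lemma after_exit w r i : tpos w -> exit_at tau H w r -> (r <= i)%N ->
  (H%:E < tau i w)%E.
Proof.
move=> pos /andP[+ _] ri; rewrite /hit pos/= -ltNge => /lt_le_trans; apply.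
exact: tau_nd.
Qed.

Lemma count_in_exit w r s t : tpos w -> exit_at tau H w r -> t <= H ->
  count_in tau s t w =
    (\sum_(i < r) ((s%:E < tau i w)%E && (tau i w <= t%:E)%E))%N%:R%:E.
Proof.
move=> pos er tH; rewrite /count_in (nneseries_split 0 r); last first.
  by move=> k _; rewrite lee_fin; case: ifP.
rewrite add0n [X in (_ + X)%E]eseries0 ?adde0; last first.
  move=> i ri _; case: ifPn => // /andP[_]; rewrite leNgt.
  by rewrite (le_lt_trans _ (after_exit pos er ri))// lee_fin.
rewrite big_mkord sumEFin natr_sum; congr (_%:E); apply: eq_bigr => i _.
by case: (_ && _).
Qed.

(** A least index that is not a hit would be an exit. Without one, every point is a hit, and the
    first k + 1 of them already push the count above k. *)
Lemma count_finite_exit w k : count_is 0 H w k -> exists r, exit_at tau H w r.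
Proof.
move=> /eqP ck; apply: contrapT => nex.
have hits : forall r, hit tau H r w.
  move=> r; elim/ltn_ind: r => r ih; apply: contrapT => /negP nr; apply: nex.
  exists r; rewrite /exit_at nr/=; apply/allP => i; rewrite mem_iota add0n/=.
  exact: ih.
have := @nneseries_lim_ge R
  (fun i => (if (0%:E < tau i w)%E && (tau i w <= H%:E)%E then 1 else 0)%:E)
  xpredT 0%N k.+1.
move=> /(_ _)/wrap[|]; first by move=> i _ _; rewrite lee_fin; case: ifP.
move: ck; rewrite /count_in => ->; rewrite big_mkord sumEFin lee_fin.
rewrite (eq_bigr (fun=> 1)); last by move=> i _; rewrite ifT//; exact: hits.
by rewrite sumr_const card_ord ler_nat ltnn.
Qed.

Lemma exit_ae : {ae P, forall w, exists r, exit_at tau H w r}.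
Proof.
(* At z = 1 [count_pow] is the indicator of a finite count on (0, H], while the Poisson generating
   function equals 1. Hence the count is almost surely finite. *)
have [|||m1 e1] := @poisson_pgf 1 (fun j => if j is 0 then 0 else H) (fun=> 1).
- by [].
- by case.
- by move=> _; rewrite ler01 lexx.
set A := [set w | exists k, count_is 0 H w k].
have mA : measurable A.
  rewrite (_ : A = \bigcup_k [set w | count_is 0 H w k]).
    by apply: bigcupT_measurable => k; exact: measurable_count_is.
  by apply/seteqP; split => w [k]; [exists k|move=> _; exists k].
have PA : P A = 1%E.
  move: e1; rewrite big_ord1 subrr mulr0 oppr0 expR0 => <-.
  rewrite -[A]setIT -integral_indic//; apply: eq_integral => w _; congr (_%:E).
  rewrite big_ord1 /= indicE; have [[k ck]|nA] := pselect (A w).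
    rewrite mem_set//; last by exists k.
    rewrite /count_pow (pick_sumE _ _ ck) ?expr1n// => i j.
    exact: count_is_uniq.
  rewrite memNset// /count_pow pick_sum0// => k.
  by apply/negP => ck; apply: nA; exists k.
by apply: filterS (ae_prob1 mA PA) => w [k]; exact: count_finite_exit.
Qed.

Lemma measurable_run_prod (f : nat -> T -> R) :
  (forall i, measurable_fun setT (f i)) -> measurable_fun setT (run_prod tau H f).
Proof.
case: pp => mtau _ _ _ mf; apply: (measurable_fun_cvg (h := fun K w =>
  \sum_(r < K) (exit_at tau H w r)%:R * \prod_(i < r) f i w)); last first.
  by move=> w _; exact: run_prod_cvg.
move=> K; apply: measurable_sum => r; apply: measurable_funM; last first.
  by apply: measurable_prod => i _.
apply: (eq_measurable_fun (fun w =>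
  (1 - arr (tau r) H w) * \prod_(i < r) arr (tau i) H w)).
  by move=> w _; rewrite exit_at_prod.
apply: measurable_funM.
  by apply: measurable_funB; [exact: measurable_cst|exact: measurable_arr].
by apply: measurable_prod => i _; exact: measurable_arr.
Qed.

Lemma measurable_fine_tau i : measurable_fun setT (fun w => fine (tau i w)).
Proof.
case: pp => mtau _ _ _.
exact: (measurableT_comp (fine_measurable measurableT) (mtau i)).
Qed.

(** Each point of (0, H] lies in exactly one interval (u_j, u_{j+1}], so after exchanging the
    products over points and intervals it contributes its value of f exactly once. *)
Lemma run_prod_step q (u : nat -> R) (f : R -> R) w :
  u 0%N = 0 -> u q = H -> (forall j, (j < q)%N -> u j < u j.+1) ->
  (forall j s, (j < q)%N -> u j < s -> s <= u j.+1 -> f s = f (u j.+1)) ->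
  tpos w -> (exists r, exit_at tau H w r) ->
  run_prod tau H (fun i w => f (fine (tau i w))) w =
    \prod_(j < q) count_pow (u j) (u j.+1) (f (u j.+1)) w.
Proof.
move=> u0 uq uu fu pos [r er]; rewrite (run_prodE _ er).
have und := nondecreasing_on uu.
pose c i j := ((u j)%:E < tau i w)%E && (tau i w <= (u j.+1)%:E)%E.
have cpow (j : 'I_q) : count_pow (u j) (u j.+1) (f (u j.+1)) w =
    \prod_(i < r) (if c i j then f (u j.+1) else 1).
  rewrite /count_pow (@pick_sumE _ (count_is (u j) (u j.+1) w) _
    (\sum_(i < r) c i j)%N).
  - elim: (r) => [|r' ih]; first by rewrite !big_ord0 expr0.
    rewrite !big_ord_recr/= exprD ih; congr (_ * _).
    by case: (c r' j); rewrite ?expr1 ?expr0.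
  - by move=> k k'; exact: count_is_uniq.
  - rewrite /count_is (count_in_exit _ pos er)// -uq; apply: und.
    by rewrite leqnn andbT.
rewrite (eq_bigr _ (fun j _ => cpow j)) exchange_big/=; apply: eq_bigr => i _.
have := exit_at_hit er (ltn_ord i); rewrite /hit.
case ts : (tau i w) => [s| |]; rewrite ?lte_fin ?lee_fin//=; last first.
  by rewrite leye_eq andbF.
move=> /andP[s0 sH].
have ex : exists j, s <= u j.+1.
  case: q uq {uu fu und cpow} => [|q] uq; last by exists q; rewrite uq.
  by exists 0%N; move: s0; rewrite -u0 uq ltNge sH.
case: (ex_minnP ex) => j sj jmin.
have jq : (j < q)%N.
  case: q uq {uu fu und cpow} => [|q] uq; last by rewrite ltnS jmin// uq.
  by move: s0; rewrite -u0 uq ltNge sH.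
have uj : u j < s.
  case: j sj jmin {jq} => [|j] sj jmin; first by rewrite u0.
  by rewrite ltNge; apply/negP => /jmin; rewrite ltnn.
rewrite (bigD1 (Ordinal jq))//= big1 ?mulr1; last first.
  move=> k kj; rewrite /c ts lte_fin lee_fin ifN//.
  apply/negP => /andP[uk ks].
  have : (j <= k)%N by exact: jmin.
  rewrite leq_eqVlt => /orP[/eqP jk|jk].
    by move: kj; rewrite -val_eqE/= jk eqxx.
  have : u j.+1 <= u k by apply: und; rewrite jk/= ltnW.
  by move=> /(le_trans sj); rewrite leNgt uk.
by rewrite /c ts lte_fin lee_fin uj sj/= (fu j s).
Qed.

Lemma poisson_step q (u : nat -> R) (f : R -> R) :
  measurable_fun setT f -> (forall s, 0 <= f s <= 1) ->
  u 0%N = 0 -> u q = H -> (forall j, (j < q)%N -> u j < u j.+1) ->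
  (forall j s, (j < q)%N -> u j < s -> s <= u j.+1 -> f s = f (u j.+1)) ->
  (\int[P]_w (run_prod tau H (fun i w => f (fine (tau i w))) w)%:E =
   (\prod_(j < q) expR (- (Lambda lam (u j) (u j.+1) * (1 - f (u j.+1)))))%:E)%E.
Proof.
move=> mf f01 u0 uq uu fu.
have [|||mz <-] := @poisson_pgf q u (fun j => f (u j.+1)).
- by rewrite u0.
- exact: uu.
- by move=> j; exact: f01.
apply: ae_eq_integral => //.
- apply/measurable_EFinP; apply: measurable_run_prod => i.
  exact: measurableT_comp mf (@measurable_fine_tau i).
- exact/measurable_EFinP.
by apply: filterS2 (points_pos_ae pp) exit_ae => w pw ew _; rewrite (run_prod_step (u := u) (q := q)).
Qed.

End poisson_counts.

(** * Measurable functions as iterated limits of step functions *)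

Section baire.
Import HBSimple.
Context {R : realType}.
Implicit Types (f g : R -> R).

(** Comparing through [x <= a] makes the pieces open on the left and closed on the right, like the
    intervals on which the Poisson points are counted. *)
Definition list_step (l : seq R) f :=
  forall x y, (forall a, a \in l -> (x <= a) = (y <= a)) -> f x = f y.

Inductive baire : (R -> R) -> Prop :=
| baire_step l f : list_step l f -> measurable_fun setT f -> baire f
| baire_lim (fs : nat -> R -> R) f : (forall q, baire (fs q)) ->
    (forall x, fs ^~ x @ \oo --> f x) -> baire f.

Lemma baire_lin (a : R) f g : baire f -> baire g -> baire (fun x => a * f x + g x).
Proof.
move=> bf bg; elim: bf => {f} [l f lf mf|fs f _ ih cf].
  elim: bg => {g} [l' g lg mg|gs g _ ih cg].
    apply: (@baire_step (l ++ l')).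
      move=> x y xy; rewrite (lf x y) ?(lg x y)// => c cl; apply: xy;
        by rewrite mem_cat cl ?orbT.
    by apply: measurable_funD => //; exact: measurable_funM.
  by apply: (baire_lim ih) => x; apply: cvgD; [exact: cvg_cst|exact: cg].
apply: (baire_lim ih) => x; apply: cvgD; last exact: cvg_cst.
by apply: cvgM; [exact: cvg_cst|exact: cf].
Qed.

Lemma baire_cst (c : R) : baire (fun=> c).
Proof. by apply: (@baire_step [::]). Qed.

(** The sets with Baire indicator form a lambda-system containing the rays ]x, +oo[, which are
    stable under intersection and generate the Borel sets. *)
Lemma baire_indic (A : set R) : measurable A -> baire \1_A.
Proof.
move=> mA; pose D := [set A : set R | baire \1_A].
pose G := [set A : set R | exists x : R, A = `]x, +oo[%classic].
have mG : <<s G >> A.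
  by move: mA; rewrite -[X in X -> _]/((ocitv (R:=R)).-sigma.-measurable A)
    RGenOInfty.measurableE.
have : <<s G >> `<=` D; last by apply.
apply: lambda_system_subset => //.
- move=> _ _ [x ->] [y ->]; exists (Num.max x y).
  by apply/seteqP; split => z /=; rewrite !in_itv/= !andbT gt_max => /andP.
- split => //.
  + by rewrite /D/= indicT; exact: baire_cst.
  + move=> B C CB bB bC; rewrite /D/=.
    rewrite (_ : \1_(B `\` C) = (fun x => -1 * \1_C x + \1_B x :> R)).
      exact: baire_lin.
    apply/funext => x; rewrite !indicE in_setD.
    have [xC|xC] := boolP (x \in C); last by rewrite andbT mulr0 add0r.
    have -> : x \in B by apply/mem_set/CB/set_mem.
    by rewrite /= mulr1 addNr.
  + move=> Fs ndF bF; rewrite /D/=; apply: (baire_lim bF) => x.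
    have [[k _ kx]|nx] := pselect ((\bigcup_k Fs k) x).
      apply: cvg_near_cst; exists k => // j /= kj.
      rewrite !indicE !mem_set//; first by exists k.
      by have /subsetPset := ndF _ _ kj; exact.
    apply: cvg_near_cst; apply: nearW => k.
    by rewrite !indicE !memNset// => kx; apply: nx; exists k.
- move=> _ [x ->]; apply: (@baire_step [:: x]).
    have e y : (y \in `]x, +oo[%classic) = ~~ (y <= x).
      by apply/idP/idP; rewrite inE/= in_itv/= andbT -ltNge.
    by move=> y z yz; rewrite !indicE !e (yz x)// mem_head.
  by apply: measurable_indic.
Qed.

(** A measurable function is a limit of simple functions, and these are finite combinations of Borel
    indicators. *)
Lemma baire_measurable f : measurable_fun setT f -> baire f.
Proof.
move=> mf; have mf' : measurable_fun setT (EFin \o f) by exact/measurable_EFinP.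
have [g gf] := approximation_sfun measurableT mf'.
apply: (@baire_lim (fun n => g n) f).
  move=> n; rewrite (_ : HBSimple.SimpleFun.sort (g n) = (fun x =>
      \sum_(y <- finmap.enum_fset (fset_set (range (g n)))) y * \1_(g n @^-1` [set y]) x)); last first.
    by apply/funext => x; rewrite [LHS]fimfunE fsbig_finite.
  elim: (finmap.enum_fset _) => [|y s ih].
    by under eq_fun do rewrite big_nil; exact: baire_cst.
  under eq_fun do rewrite big_cons; apply: baire_lin => //.
  apply: baire_indic; exact: measurable_sfunP.
move=> x; have := gf x I; move=> /fine_cvgP[_]; exact.
Qed.

End baire.

Lemma cvg_prodr {R : realType} r (v : nat -> nat -> R) (l : nat -> R) :
  (forall i, v ^~ i @ \oo --> l i) ->
  (fun q => \prod_(i < r) v q i) @ \oo --> \prod_(i < r) l i.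
Proof.
move=> vl; elim: r => [|r ih].
  by under eq_fun do rewrite big_ord0; rewrite big_ord0; exact: cvg_cst.
under eq_fun do rewrite big_ord_recr; rewrite big_ord_recr/=.
by apply: cvgM; [exact: ih|exact: vl].
Qed.

Lemma dominated_cvg_real {R : realType} {d} {T : measurableType d}
    (mu : measure T R) (D : set T) (h : nat -> T -> R) (f g : T -> R) :
  measurable D -> (forall q, measurable_fun D (h q)) ->
  (forall x, D x -> h ^~ x @ \oo --> f x) ->
  mu.-integrable D (EFin \o g) ->
  (forall q x, D x -> `|h q x| <= g x) ->
  (fun q => \int[mu]_(x in D) (h q x)%:E)%E @ \oo -->
    (\int[mu]_(x in D) (f x)%:E)%E.
Proof.
move=> mD mh hf ig hg.
have mf : measurable_fun D f by apply: (measurable_fun_cvg mh).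
have mh' q : measurable_fun D (EFin \o h q) by exact/measurable_EFinP.
have mf' : measurable_fun D (EFin \o f) by exact/measurable_EFinP.
have hf' : {ae mu, forall x, D x ->
    (fun q => (EFin \o h q) x) @ \oo --> (EFin \o f) x}.
  by apply: aeW => x Dx; apply: cvg_EFin; [exact: nearW|exact: hf].
have hg' : {ae mu, forall x q, D x -> (`|(EFin \o h q) x| <= (EFin \o g) x)%E}.
  by apply: aeW => x q Dx /=; rewrite lee_fin hg.
by have [] := dominated_convergence mD mh' mf' hf' ig hg'.
Qed.

(** * Laplace functional for measurable functions *)

Section poisson_laplace.
Context {R : realType} {d : measure_display} {T : measurableType d}.
Variables (P : probability T R) (lam : R -> R) (tau : nat -> T -> \bar R).
Variable H : R.
Hypothesis H0 : 0 < H.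
Hypothesis lam0 : forall x, 0 <= lam x.
Hypothesis ilam : (@lebesgue_measure R).-integrable `[0, H] (fun x => (lam x)%:E).
Hypothesis pp : poisson_points P lam tau.

Let ilam' : (@lebesgue_measure R).-integrable `]0, H] (fun x => (lam x)%:E).
Proof.
apply: integrableS ilam => //.
by apply: subset_itvr; rewrite bnd_simp.
Qed.

Let mlam : measurable_fun `]0, H] lam.
Proof. by apply/measurable_EFinP; exact: measurable_int ilam'. Qed.

Lemma integral_step (q : nat) (u : nat -> R) (f : R -> R) :
  (forall s, 0 <= f s <= 1) -> measurable_fun setT f ->
  u 0%N = 0 -> u q = H -> (forall j, (j < q)%N -> u j < u j.+1) ->
  (forall j s, (j < q)%N -> u j < s -> s <= u j.+1 -> f s = f (u j.+1)) ->
  (\int[lebesgue_measure]_(s in `]0%R, H]) ((1 - f s) * lam s)%:E =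
  (\sum_(j < q) Lambda lam (u j) (u j.+1) * (1 - f (u j.+1)))%:E)%E.
Proof.
move=> f01 mf u0 uq uu fu.
have und := nondecreasing_on uu.
have mD : measurable_fun `]0, H] (fun s => ((1 - f s) * lam s)%:E).
  apply/measurable_EFinP; apply: measurable_funM => //.
  by apply: measurable_funB; [exact: measurable_cst|exact: measurable_funTS].
have f1 s : 0 <= 1 - f s by rewrite subr_ge0; case/andP: (f01 s).
have f0 s : (0 <= ((1 - f s) * lam s)%:E)%E by rewrite lee_fin mulr_ge0.
rewrite -u0 -uq (integral_partition uu) ?u0 ?uq// -sumEFin.
apply: eq_bigr => k _; have kq := ltn_ord k.
have sub : `]u k, u k.+1] `<=` `]0, H].
  apply: subset_itv; rewrite bnd_simp -?u0 -?uq; apply: und.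
    by rewrite leq0n/= ltnW.
  by rewrite kq leqnn.
have il : (@lebesgue_measure R).-integrable `]u k, u k.+1] (fun x => (lam x)%:E).
  exact: integrableS ilam'.
under eq_integral => s su.
  have -> : ((1 - f s) * lam s)%:E = ((1 - f (u k.+1))%:E * (lam s)%:E)%E.
    move: su; rewrite inE/= in_itv/= => /andP[us su].
    by rewrite (fu k s)// EFinM.
  over.
rewrite integralZl// EFinM muleC /Lambda fineK//.
exact: integrable_fin_num.
Qed.

Definition clamp01 (x : R) : R := Num.max 0 (Num.min 1 x).

Lemma clamp01_bounds x : 0 <= clamp01 x <= 1.
Proof. by rewrite /clamp01 le_max lexx/= ge_max ler01 ge_min lexx. Qed.

Lemma clamp01_id x : 0 <= x <= 1 -> clamp01 x = x.
Proof. by move=> /andP[x0 x1]; rewrite /clamp01 min_r// max_r. Qed.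

Lemma clamp01_cvg (u : nat -> R) l : u @ \oo --> l ->
  (fun q => clamp01 (u q)) @ \oo --> clamp01 l.
Proof.
move=> ul; rewrite /clamp01.
have um : (fun q => Num.min 1 (u q)) @ \oo --> Num.min 1 l.
  rewrite minr_absE; under eq_fun do rewrite minr_absE.
  apply: cvgM; last exact: cvg_cst.
  apply: cvgB; first by apply: cvgD; [exact: cvg_cst|].
  by apply: cvg_norm; apply: cvgB; [exact: cvg_cst|].
rewrite maxr_absE; under eq_fun do rewrite maxr_absE.
apply: cvgM; last exact: cvg_cst.
apply: cvgD; first by apply: cvgD; [exact: cvg_cst|].
by apply: cvg_norm; apply: cvgB; [exact: cvg_cst|].
Qed.

Lemma measurable_clamp01 d' (U : measurableType d') (f : U -> R) :
  measurable_fun setT f -> measurable_fun setT (fun x => clamp01 (f x)).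
Proof.
move=> mf; apply: measurable_maxr; first exact: measurable_cst.
by apply: measurable_minr; first exact: measurable_cst.
Qed.

(* The truncation [clamp01] makes dominated convergence available along the
   arbitrary pointwise limits that generate the Baire functions. *)
Let laplace (f : R -> R) :=
  (\int[P]_w (run_prod tau H (fun i w => f (fine (tau i w))) w)%:E =
   (expR (- fine (\int[lebesgue_measure]_(s in `]0%R, H]) ((1 - f s) * lam s)%:E)))%:E)%E.

(** The breakpoints inside (0, H), without repetition and sorted, together with the ends 0 and H,
    form a subdivision on whose intervals f is constant. *)
Lemma laplace_step l (f : R -> R) : list_step l f -> measurable_fun setT f ->
  (forall s, 0 <= f s <= 1) -> laplace f.
Proof.
move=> lf mf f01.
pose m := sort <=%R (undup [seq a <- l | (0 < a) && (a < H)]).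
have mm a : (a \in m) = [&& a \in l, 0 < a & a < H].
  by rewrite mem_sort mem_undup mem_filter andbC.
pose u j := nth H (0 :: rcons m H) j.
have pm : path <%R 0 (rcons m H).
  rewrite rcons_path; apply/andP; split.
    rewrite path_min_sorted; last by apply/allP => a; rewrite mm => /and3P[].
    by rewrite sort_lt_sorted undup_uniq.
  have : last 0 m \in 0 :: m by exact: mem_last.
  by rewrite in_cons mm => /orP[/eqP ->|/and3P[]].
pose q := (size m).+1.
have u0 : u 0%N = 0 by [].
have uq : u q = H by rewrite /u/= nth_rcons ltnn eqxx.
have uu j : (j < q)%N -> u j < u j.+1.
  by move=> jq; move/(pathP H) : pm; apply; rewrite size_rcons.
have und := nondecreasing_on uu.
have fu j s : (j < q)%N -> u j < s -> s <= u j.+1 -> f s = f (u j.+1).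
  (* A breakpoint a with s <= a < u_{j+1} would itself be one of the u_i, yet lie strictly between
     two consecutive ones. *)
  move=> jq us su; apply: lf => a al; apply/idP/idP; last exact: le_trans.
  move=> sa; rewrite leNgt; apply/negP => au.
  have : a \in m.
    have uj0 : u 0%N <= u j by apply: und; rewrite leq0n/= ltnW.
    have ujH : u j.+1 <= u q by apply: und; rewrite jq leqnn.
    by rewrite mm al (le_lt_trans uj0 (lt_le_trans us sa))
      (lt_le_trans au)// -uq.
  move=> /(nthP H)[i im ia].
  have ui : u i.+1 = a by rewrite /u/= nth_rcons im.
  have [ij|ij] := leqP i.+1 j.
    have : u i.+1 <= u j by apply: und; rewrite ij/= ltnW.
    by rewrite ui leNgt (lt_le_trans us sa).
  have : u j.+1 <= u i.+1 by apply: und; rewrite ij/= /q ltnS ltnW.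
  by rewrite ui leNgt au.
rewrite /laplace (poisson_step lam0 pp H0 mf f01 u0 uq uu fu).
rewrite (integral_step f01 mf u0 uq uu fu)/= -sumrN.
by congr (_%:E); rewrite expR_sum.
Qed.

Lemma poisson_laplace (f : R -> R) : measurable_fun setT f -> (forall s, 0 <= f s <= 1) ->
  laplace f.
Proof.
move=> mf f01; suff : laplace (fun s => clamp01 (f s)).
  by congr laplace; apply/funext => s; rewrite clamp01_id.
suff : forall f : R -> R, baire f -> measurable_fun setT f /\ laplace (fun s => clamp01 (f s)).
  by move=> h; case: (h _ (baire_measurable mf)).
move=> {mf f01}g; elim => {f g} [l f lf mf|fs f _ ih cf].
  split => //; apply: (@laplace_step l).
  - by move=> x y /lf ->.
  - exact: measurable_clamp01.
  - by move=> s; exact: clamp01_bounds.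
have mfs q : measurable_fun setT (fs q) by case: (ih q).
have mf : measurable_fun setT f by apply: (measurable_fun_cvg mfs) => x _; exact: cf.
have mt i : measurable_fun setT (fun w => fine (tau i w)).
  exact: (@measurable_fine_tau _ _ _ _ _ _ pp i).
split => //; rewrite /laplace.
have c1 : (fun q => \int[P]_w
      (run_prod tau H (fun i w => clamp01 (fs q (fine (tau i w)))) w)%:E)%E @ \oo -->
    (\int[P]_w (run_prod tau H (fun i w => clamp01 (f (fine (tau i w)))) w)%:E)%E.
  apply: (@bounded_cvg_integral _ _ _ P (fun q =>
    run_prod tau H (fun i w => clamp01 (fs q (fine (tau i w))))) _ 1).
  - move=> q; apply: (measurable_run_prod pp) => i.
    exact: (measurable_clamp01 (measurableT_comp (mfs q) (mt i))).
  - apply: (measurable_run_prod pp) => i.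
    exact: (measurable_clamp01 (measurableT_comp mf (mt i))).
  - move=> q w; apply: run_prod_norm => i _.
    by case/andP: (clamp01_bounds (fs q (fine (tau i w)))) => ? ?; rewrite ger0_norm.
  - apply: aeW => w; have [[r er]|ner] := pselect (exists r, exit_at tau H w r).
      rewrite (run_prodE _ er) (_ : (fun q => _) =
        (fun q => \prod_(i < r) clamp01 (fs q (fine (tau i w))))).
        apply: (@cvg_prodr _ r (fun q i => clamp01 (fs q (fine (tau i w))))
          (fun i => clamp01 (f (fine (tau i w))))).
        by move=> i; exact/clamp01_cvg/cf.
      by apply/funext => q; rewrite (run_prodE _ er).
    have e0 h : run_prod tau H h w = 0.
      by apply: pick_sum0 => r; apply/negP => er; apply: ner; exists r.
    by under eq_fun do rewrite e0; rewrite e0; exact: cvg_cst.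
have c2 : (fun q => \int[lebesgue_measure]_(s in `]0%R, H])
        ((1 - clamp01 (fs q s)) * lam s)%:E)%E @ \oo -->
      (\int[lebesgue_measure]_(s in `]0%R, H]) ((1 - clamp01 (f s)) * lam s)%:E)%E.
  apply: (@dominated_cvg_real _ _ _ (@lebesgue_measure R) `]0, H]
    (fun q s => (1 - clamp01 (fs q s)) * lam s)
    (fun s => (1 - clamp01 (f s)) * lam s) lam) => //.
  - move=> q; apply: measurable_funM => //.
    apply: measurable_funB; first exact: measurable_cst.
    by apply: measurable_funTS; exact: (measurable_clamp01 (mfs q)).
  - move=> s _; apply: cvgM; last exact: cvg_cst.
    by apply: cvgB; [exact: cvg_cst|exact/clamp01_cvg/cf].
  - move=> q s _; rewrite normrM (ger0_norm (lam0 s)).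
    rewrite ler_piMl//; case/andP: (clamp01_bounds (fs q s)) => c0 c1'.
    by rewrite ger0_norm ?subr_ge0// lerBlDr lerDl.
have fin g : measurable_fun setT g -> (\int[lebesgue_measure]_(s in `]0%R, H])
     ((1 - clamp01 (g s)) * lam s)%:E)%E \is a fin_num.
  move=> mg; apply: integrable_fin_num => //.
  apply: (@le_integrable _ _ R (@lebesgue_measure R) `]0%R, H] (measurable_itv _)
    (fun s => ((1 - clamp01 (g s)) * lam s)%:E) (EFin \o lam)); last exact: ilam'.
    apply/measurable_EFinP; apply: measurable_funM => //.
    apply: measurable_funB; first exact: measurable_cst.
    by apply: measurable_funTS; exact: (measurable_clamp01 mg).
  move=> s _; rewrite lee_fin normrM.
  rewrite ler_piMl//; case/andP: (clamp01_bounds (g s)) => c0 c1'.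
  by rewrite ger0_norm ?subr_ge0// lerBlDr lerDl.
rewrite -(cvg_lim _ c1)//; apply: cvg_lim => //.
rewrite (_ : (fun q => _) = (fun q => (expR (- fine
   (\int[lebesgue_measure]_(s in `]0%R, H])
        ((1 - clamp01 (fs q s)) * lam s)%:E)))%:E)); last first.
  by apply/funext => q; have [_] := ih q.
apply: cvg_EFin; first exact: nearW.
apply: continuous_cvg; first exact: continuous_expR.
by apply: cvgN; apply: fine_cvg; rewrite fineK// fin.
Qed.

End poisson_laplace.

(** * The transform of the queue for fixed n *)

Section size_gf.
Context {R : realType}.
Variables (mu : R -> probability R R) (n : nat).
Implicit Types (r s b : R).

Definition ceil_is (b : R) (k : nat) : bool := Num.ceil (n%:R * b) == k%:Z.

Lemma ceil_is_uniq b k k' : ceil_is b k -> ceil_is b k' -> k = k'.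
Proof. by rewrite /ceil_is => /eqP -> /eqP[]. Qed.

(** Generating function at r of the size ceil(n B_s), where a negative ceiling contributes 0. *)
Definition size_gf (s r : R) : R :=
  fine (\int[mu s]_b (pick_sum (ceil_is b) (fun k => r ^+ k))%:E).

Lemma measurable_ceil_is k : measurable_fun setT (fun b => (ceil_is b k)%:R : R).
Proof.
apply: measurable_fun_bool_natr; apply: (measurable_fun_bool true).
rewrite setTI (_ : _ @^-1` _ = [set b | Num.ceil (n%:R * b) = k%:Z]).
  exact: measurable_ceil_eq.
by apply/seteqP; split => b /= /eqP.
Qed.

Lemma pick_ceil_measurable r :
  measurable_fun setT (fun b => pick_sum (ceil_is b) (fun k => r ^+ k) : R).
Proof.
apply: (measurable_fun_cvg (h := fun K b => \sum_(k < K) (ceil_is b k)%:R * r ^+ k)).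
  move=> K; apply: measurable_sum => k; apply: measurable_funM.
    exact: measurable_ceil_is.
  exact: measurable_cst.
move=> b _; apply: (@pick_sum_cvg _ (ceil_is b)) => k k'; exact: ceil_is_uniq.
Qed.

Lemma pick_ceil_partial_bound r b K : 0 <= r <= 1 ->
  `|\sum_(k < K) (ceil_is b k)%:R * r ^+ k| <= 1.
Proof.
move=> /andP[r0 r1].
apply: (@psum_bound _ (ceil_is b) (fun k => r ^+ k)) => //.
  by move=> k k'; exact: ceil_is_uniq.
by move=> k _; rewrite ger0_norm ?exprn_ge0// exprn_ile1.
Qed.

Lemma pick_ceil_ge0 r b : 0 <= r -> 0 <= pick_sum (ceil_is b) (fun k => r ^+ k) :> R.
Proof.
move=> r0; have [[k ck]|nc] := pselect (exists k, ceil_is b k).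
  rewrite (pick_sumE _ _ ck) ?exprn_ge0// => i j; exact: ceil_is_uniq.
by rewrite pick_sum0// => k; apply/negP => ck; apply: nc; exists k.
Qed.

Lemma pick_ceil_norm r b : 0 <= r <= 1 ->
  `|pick_sum (ceil_is b) (fun k => r ^+ k) : R| <= 1.
Proof.
move=> r01; apply: (cvg_norm_le (u := fun K => \sum_(k < K) (ceil_is b k)%:R * r ^+ k)).
  by move=> K; exact: pick_ceil_partial_bound.
apply: (@pick_sum_cvg _ (ceil_is b)) => k k'; exact: ceil_is_uniq.
Qed.

Lemma size_partial_integral s r K : 0 <= r <= 1 ->
  (\int[mu s]_b (\sum_(k < K) (ceil_is b k)%:R * r ^+ k)%:E =
   (\sum_(k < K) size_prob n mu s k * r ^+ k)%:E)%E.
Proof.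
move=> /andP[r0 r1].
under eq_integral do rewrite -sumEFin.
rewrite ge0_integral_sum//; first last.
- by move=> k b _; rewrite lee_fin mulr_ge0 ?exprn_ge0.
- move=> k; apply/measurable_EFinP; apply: measurable_funM.
    exact: measurable_ceil_is.
  exact: measurable_cst.
rewrite -sumEFin; apply: eq_bigr => k _.
under eq_integral do rewrite mulrC EFinM.
rewrite ge0_integralZl//; first last.
- by rewrite lee_fin exprn_ge0.
- apply/measurable_EFinP; exact: measurable_ceil_is.
rewrite mulrC EFinM; congr (_ * _)%E.
rewrite /size_prob fineK ?fin_num_measure//; last exact: measurable_ceil_eq.
rewrite -[X in mu s X]setIT -integral_indic//; last exact: measurable_ceil_eq.
apply: eq_integral => b _; congr (_%:E); rewrite indicE; congr (_ : bool)%:R.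
apply/idP/idP; first by move=> /eqP h; apply/mem_set.
by move=> /set_mem h; apply/eqP.
Qed.

Lemma size_gf_cvg s r : 0 <= r <= 1 ->
  (fun K => \sum_(k < K) size_prob n mu s k * r ^+ k) @ \oo --> size_gf s r.
Proof.
move=> r01; rewrite /size_gf.
have c := @bounded_cvg_integral _ _ _ (mu s)
  (fun K b => \sum_(k < K) (ceil_is b k)%:R * r ^+ k)
  (fun b => pick_sum (ceil_is b) (fun k => r ^+ k)) 1.
have {}c := c _ (@pick_ceil_measurable r) _ _.
suff : ((fun K => (\sum_(k < K) size_prob n mu s k * r ^+ k)%:E) @ \oo -->
    (fine (\int[mu s]_b (pick_sum (ceil_is b) (fun k => r ^+ k))%:E))%:E)%E.
  by move=> cE; exact: (fine_cvg cE).
rewrite fineK; last first.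
  apply: integrable_fin_num => //.
  apply: (@bounded_integrable _ _ _ _ _ 1); first exact: pick_ceil_measurable.
  by move=> b; exact: pick_ceil_norm.
under eq_fun do rewrite -size_partial_integral//.
apply: c.
- move=> K; apply: measurable_sum => k; apply: measurable_funM.
    exact: measurable_ceil_is.
  exact: measurable_cst.
- by move=> K b; exact: pick_ceil_partial_bound.
- apply: aeW => b; apply: (@pick_sum_cvg _ (ceil_is b)) => k k'; exact: ceil_is_uniq.
Qed.

Lemma size_gf_partial_bound s r K : 0 <= r <= 1 ->
  `|\sum_(k < K) size_prob n mu s k * r ^+ k| <= 1.
Proof.
move=> r01; rewrite -lee_fin -abse_EFin -size_partial_integral//.
have mi : measurable_fun setT (fun b => \sum_(k < K) (ceil_is b k)%:R * r ^+ k : R).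
  apply: measurable_sum => k; apply: measurable_funM.
    exact: measurable_ceil_is.
  exact: measurable_cst.
apply: (le_trans (le_abse_integral _ _ _)) => //; first exact/measurable_EFinP.
apply: (@le_trans _ _ (\int[mu s]_b 1%:E)%E); last first.
  by rewrite integral_cst//= probability_setT mule1.
apply: ge0_le_integral => //.
- by apply: measurableT_comp => //; exact/measurable_EFinP.
- by move=> b _ /=; rewrite lee_fin; exact: pick_ceil_partial_bound.
Qed.

Lemma size_gf01 s r : 0 <= r <= 1 -> 0 <= size_gf s r <= 1.
Proof.
move=> r01; have /andP[r0 r1] := r01; apply/andP; split.
  by rewrite fine_ge0// integral_ge0// => b _; rewrite lee_fin pick_ceil_ge0.
apply: (le_trans (ler_norm _)).
apply: (cvg_norm_le _ (@size_gf_cvg s r r01)) => K; exact: size_gf_partial_bound.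
Qed.

End size_gf.

Section queue_transform.
Context {R : realType} {d : measure_display} {T : measurableType d}.
Variables (n : nat) (P : probability T R) (lam : R -> R).
Variables (mu : R -> probability R R) (F : R -> R -> R).
Variables (tau : nat -> T -> \bar R) (N : nat -> T -> nat).
Variables (S : nat -> nat -> T -> R) (H : R).
Hypothesis H0 : 0 < H.
Hypothesis lam0 : forall x, 0 <= lam x.
Hypothesis ilam : (@lebesgue_measure R).-integrable `[0, H] (fun x => (lam x)%:E).
Hypothesis mmu : forall A, measurable A -> measurable_fun setT (fun s => mu s A).
Hypothesis cF : forall s, 0 <= s -> is_cdf_nonneg (F s).
Hypothesis mF : measurable_fun setT (fun p : R * R => F p.1 p.2).
Hypothesis bq : batch_queue n P lam mu F tau N S.

Variables (a b t : nat -> R) (l : seq nat).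
Hypothesis a01 : {in l, forall x, 0 <= a x <= 1}.
Hypothesis b01 : {in l, forall x, 0 <= b x <= 1}.
Hypothesis tl : pairwise (fun x z => t x <= t z) l.

(** A customer arriving after t_x is neither present nor departed at t_x, so it contributes the
    factor 1 for that time. *)
Let as_ (s : R) x := if s <= t x then a x else 1.

Let as01 s : {in l, forall x, 0 <= as_ s x <= 1}.
Proof. by move=> x xl; rewrite /as_; case: ifP => _; [exact: a01|rewrite ler01 lexx]. Qed.

Definition customer_factor (s x : R) : R :=
  psi (as_ s) b (fun k => (x <= t k - s)%R%:R) l.

Definition service_gf (s : R) : R :=
  psi (as_ s) b (fun k => F s (t k - s)) l.

Lemma customer_factor01 s x : 0 <= customer_factor s x <= 1.
Proof.
apply: psi_bounds => //.
  by move=> k _; case: (x <= t k - s); rewrite ?lexx ?ler01.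
move: tl; apply: sub_pairwise => y z yz.
case: (leP x (t y - s)) => h; last by rewrite ler0n.
by rewrite (le_trans h)// lerD2r.
Qed.

Lemma customer_factorE s x : customer_factor s x =
  \prod_(k <- l) (if x <= t k - s then b k else as_ s k).
Proof.
rewrite /customer_factor (psi_bool _ _ (th := fun k => x <= t k - s))//.
move: tl; apply: sub_pairwise => y z yz; apply/implyP => h.
by rewrite (le_trans h)// lerD2r.
Qed.

Lemma service_gf01 s : 0 <= s -> 0 <= service_gf s <= 1.
Proof.
move=> s0; have cs := cF s0; apply: psi_bounds => //.
  by move=> k _; exact: cdf01.
case: cs => nd _ _ _; move: tl; apply: sub_pairwise => y z yz.
by apply: nd; rewrite lerD2r.
Qed.

Lemma measurable_service_gf : measurable_fun setT service_gf.
Proof.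
rewrite /service_gf; elim: l => [|k s ih] /=; first exact: measurable_cst.
have mle : measurable_fun setT (fun s : R => s <= t k).
  by apply: measurable_fun_ler => //; exact: measurable_cst.
have mas : measurable_fun setT (as_ ^~ k).
  by apply: measurable_fun_ifT => //; exact: measurable_cst.
have mFk : measurable_fun setT (fun s => F s (t k - s)).
  have mp : measurable_fun setT (fun s : R => (s, t k - s)).
    apply: measurable_fun_pair => //.
    by apply: measurable_funB => //; exact: measurable_cst.
  exact: (measurableT_comp mF mp).
apply: measurable_funD; first exact: measurable_funM.
apply: measurable_funM; last exact: measurable_cst.
apply: measurable_funM => //; apply: measurable_funB => //; exact: measurable_cst.
Qed.

(** The value 0 outside (0, H] keeps this in [0, 1] on the whole line, as the Laplace functional
    requires; [F s] need not be a CDF for s < 0. *)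
Definition batch_gf (s : R) : R :=
  if (0 < s) && (s <= H) then size_gf mu n s (service_gf s) else 0.

Lemma batch_gf01 s : 0 <= batch_gf s <= 1.
Proof.
rewrite /batch_gf; case: ifPn => [/andP[/ltW s0 _]|_]; last by rewrite lexx ler01.
by apply: size_gf01; exact: service_gf01.
Qed.

Lemma measurable_batch_gf : measurable_fun setT batch_gf.
Proof.
pose h K (s : R) := if (0 < s) && (s <= H) then
  \sum_(k < K) size_prob n mu s k * service_gf s ^+ k else 0.
apply: (@measurable_fun_cvg _ _ _ _ h).
  move=> K; rewrite /h; apply: measurable_fun_ifT => //.
    apply: measurable_and.
      by apply: measurable_fun_ltr => //; exact: measurable_cst.
    by apply: measurable_fun_ler => //; exact: measurable_cst.
  apply: measurable_sum => k; apply: measurable_funM.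
    exact: measurable_size_prob.
  by apply: measurable_funX; exact: measurable_service_gf.
move=> s _; rewrite /batch_gf /h; case: ifPn => [/andP[/ltW s0 _]|_].
  by apply: size_gf_cvg; exact: service_gf01.
exact: cvg_cst.
Qed.

Definition queue_factor (i : nat) (w : T) : R :=
  \prod_(j < N i w) customer_factor (fine (tau i w)) (S i j w).

Lemma queue_factor_norm i w : `|queue_factor i w| <= 1.
Proof.
apply: prodr_norm_le1 => j.
by case/andP: (customer_factor01 (fine (tau i w)) (S i j w)) => ? ?; rewrite ger0_norm.
Qed.

Lemma queue_transform :
  measurable_fun setT (run_prod tau H queue_factor) /\
  (\int[P]_w (run_prod tau H queue_factor w)%:E =
   (expR (- fine (\int[lebesgue_measure]_(s in `]0%R, H])
      ((1 - batch_gf s) * lam s)%:E)))%:E)%E.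
Proof.
have pp : poisson_points P lam tau by case: bq.
have p01 s k := size_prob01 n mu s k.
pose bpair i := batch_pair (tau i) (N i) (S i) F (size_prob n mu).
have bb i : pbounded (bpair i) by exact: batch_pair_bounded.
have pb i : pcl (bpair i) (fun w => arr (tau i) H w * queue_factor i w)
    (fun w => arr (tau i) H w * batch_gf (fine (tau i w))).
  apply: (@pcl_batch _ _ _ _ _ _ _ H cF p01 
    (fun j w => customer_factor (fine (tau i w)) (S i j w)) service_gf).
  - by move=> j w; exact: customer_factor01.
  - move=> s s0 sH; rewrite /batch_gf s0 sH/=; apply: size_gf_cvg.
    exact/service_gf01/ltW.
  - by move=> s K s0 sH; apply: size_gf_partial_bound; exact/service_gf01/ltW.
  - move=> j; exact: pcl_psi.
have := pcl_run bb (H := H) (tau := tau) (h := queue_factor)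
  (g := fun i w => batch_gf (fine (tau i w))) _ _ pb.
move=> /(_ _ _)/wrap[||].
- by move=> i w _; exact: queue_factor_norm.
- move=> i w _; case/andP: (batch_gf01 (fine (tau i w))) => ? ?.
  by rewrite ger0_norm.
move=> /(pcl_integral (P := P) (run_pair_bounded bb))[||m1 _ e1].
- by move=> h g; exact: (measurable_run_pair mmu mF bq).
- by move=> h g; exact: (run_pair_integral mmu mF bq).
split => //; rewrite e1.
apply: (poisson_laplace H0 lam0 ilam pp); first exact: measurable_batch_gf.
exact: batch_gf01.
Qed.

End queue_transform.

(** * Queue lengths and departures as a product over customers *)

Section queue_identity.
Context {R : realType} {d : measure_display} {T : measurableType d}.
Variables (n : nat) (P : probability T R) (lam : R -> R).
Variables (mu : R -> probability R R) (F : R -> R -> R).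
Variables (tau : nat -> T -> \bar R) (N : nat -> T -> nat).
Variables (S : nat -> nat -> T -> R) (H : R).
Hypothesis H0 : 0 < H.
Hypothesis mmu : forall A, measurable A -> measurable_fun setT (fun s => mu s A).
Hypothesis cF : forall s, 0 <= s -> is_cdf_nonneg (F s).
Hypothesis mF : measurable_fun setT (fun p : R * R => F p.1 p.2).
Hypothesis bq : batch_queue n P lam mu F tau N S.

Let pp : poisson_points P lam tau. Proof. by case: bq. Qed.

(* A null box containing the paths for which the work of customer j of batch i
   is at most -1/(q+1); the bound Q is irrelevant for the other customers. *)
Lemma service_box_null i j q Q (ks : nat -> nat) : (j < ks i)%N ->
  {ae P, forall w, ~ ((forall i', (i' < i.+1)%N -> (tau i' w < +oo)%E) /\
    (forall i', (i' < i.+1)%N -> N i' w = ks i' /\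
      (forall j', (j' < ks i')%N -> S i' j' w <=
         (if (i' == i) && (j' == j) then - (q.+1%:R)^-1 else Q%:R))))}.
Proof.
move=> jk; case: bq => -[mtau _ _ _] mN mS hP.
pose x i' j' : R := if (i' == i) && (j' == j) then - (q.+1%:R)^-1 else Q%:R.
pose E := [set w | (forall i', (i' < i.+1)%N -> (tau i' w < +oo)%E) /\
                   (forall i', (i' < 0)%N -> (tau i' w <= 0%:E)%E)].
pose A := [set w | forall i', (i' < i.+1)%N ->
  N i' w = ks i' /\ (forall j', (j' < ks i')%N -> S i' j' w <= x i' j')].
have mE : measurable E.
  apply: measurableI; apply: measurable_forall_lt => i';
    rewrite -[X in measurable X]setTI.
    by apply: measurable_lte => //; exact: measurable_cst.
  by apply: measurable_lee => //; exact: measurable_cst.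
have mA : measurable A.
  apply: measurable_forall_lt => i'; apply: measurableI; first exact: mN.
  apply: measurable_forall_lt => j'; rewrite -[X in measurable X]setTI.
  by apply: measurable_fun_le => //; exact: measurable_cst.
exists (E `&` A); split; first exact: measurableI.
  (* With p = 0 no arrival time is bounded: the event only asks that batches 0 to i exist. *)
  rewrite [LHS](hP i.+1 0%N (fun=> 0) ks x) -/E integral_mkcond.
  transitivity (\int[P]_w (cst 0 w))%E; last by rewrite integral_cst// mul0e.
  apply: ae_eq_integral => //.
  - rewrite (_ : _ \_ _ = fun w => (\1_E w *
      \prod_(i0 < i.+1) batch_prob n mu F (fine (tau i0 w)) (ks i0) (x i0))%:E); last first.
      apply/funext => w; rewrite patchE indicE; case: (w \in E) => //=.
        by rewrite mul1r.
      by rewrite mul0r.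
    apply/measurable_EFinP; apply: measurable_funM; first exact: measurable_indic.
    apply: measurable_prod => i' _; apply: measurable_funM.
      apply: (measurableT_comp (@measurable_size_prob _ n mu mmu (ks i'))).
      exact: (@measurable_fine_tau _ _ _ _ _ _ pp i').
    apply: measurable_prod => j' _.
    exact: (@measurable_F_arrival _ _ _ _ _ _ _ _ _ _ _ mF bq).
  (* The factor of customer j of batch i is a CDF at a negative number, hence 0; the CDF properties
     of [F] at the arrival time come from the positivity of the points. *)
  - apply: filterS (points_pos_ae pp) => w pos _; rewrite patchE; case: ifPn => // wE.
    rewrite /= (bigD1 (Ordinal (ltnSn i)))//= /batch_prob (bigD1 (Ordinal jk))//=.
    rewrite /x !eqxx/=; have [s0 _ Fneg _] : is_cdf_nonneg (F (fine (tau i w))).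
      by apply: cF; rewrite fine_ge0// ltW.
    by rewrite Fneg ?oppr_lt0 ?invr_gt0// mul0r mulr0 mul0r.
move=> w /= /contrapT[h1 h2]; split; first by split.
exact: h2.
Qed.

(* A customer with negative work could depart before time H although its batch
   arrives after H. *)
Lemma service_ge0_ae : {ae P, forall w, forall i j, (tau i w < +oo)%E ->
  (j < N i w)%N -> 0 <= S i j w}.
Proof.
(* Vectors of batch sizes are coded by naturals, so that the exceptional boxes form a countable
   family. *)
pose ksc c := nth 0%N (odflt [::] (@unpickle (seq nat) c)).
have h : {ae P, forall w, forall i j q Q c,
  (j < ksc c i)%N -> ~ ((forall i', (i' < i.+1)%N -> (tau i' w < +oo)%E) /\
    (forall i', (i' < i.+1)%N -> N i' w = ksc c i' /\
      (forall j', (j' < ksc c i')%N -> S i' j' w <=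
         (if (i' == i) && (j' == j) then - (q.+1%:R)^-1 else Q%:R))))}.
  apply: ae_foralln => i; apply: ae_foralln => j; apply: ae_foralln => q.
  apply: ae_foralln => Q; apply: ae_foralln => c.
  case: (ltnP j (ksc c i)) => jk; last exact: aeW.
  by apply: filterS (service_box_null q Q jk) => w hw _.
apply: filterS h => w hw i j ti jN; rewrite leNgt; apply/negP => S0.
have [q hq] : exists q, S i j w <= - (q.+1%:R)^-1.
  exists (Num.truncn (- S i j w)^-1); rewrite lerNr.
  rewrite -[leRHS]invrK lef_pV2 ?posrE ?ltr0n ?invr_gt0 ?oppr_gt0//.
  by rewrite ltW// truncnS_gt.
(* M dominates all works of batches 0 to i, so an integer above M serves as the bound Q of a null
   box containing the path. *)
pose M := \sum_(i' < i.+1) \sum_(j' < N i' w) `|S i' j' w|.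
have SM i' j' : (i' < i.+1)%N -> (j' < N i' w)%N -> S i' j' w <= M.
  move=> ii jj; apply: (le_trans (ler_norm _)).
  rewrite /M (bigD1 (Ordinal ii))//= (bigD1 (Ordinal jj))//= -addrA lerDl.
  by rewrite addr_ge0// sumr_ge0// => k _; rewrite sumr_ge0.
have MQ : M <= (Num.truncn M).+1%:R by rewrite ltW// truncnS_gt.
pose ks := mkseq (N^~ w) i.+1.
have ksE i' : (i' < i.+1)%N -> nth 0%N ks i' = N i' w by move=> ii; rewrite nth_mkseq.
apply: (hw i j q (Num.truncn M).+1 (pickle ks)); rewrite /ksc pickleK/=.
  by rewrite ksE.
split => i' ii.
  by apply: le_lt_trans ti; apply: (tau_nd pp); rewrite -ltnS.
rewrite ksE//; split => // j' jj; case: ifPn => [/andP[/eqP -> /eqP ->] //|_].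
by apply: le_trans MQ; exact: SM.
Qed.

Lemma fine_eseries_finite (g : nat -> R) r : (forall i, 0 <= g i) ->
  (forall i, (r <= i)%N -> g i = 0) ->
  fine (\sum_(i <oo) (g i)%:E)%E = \sum_(i < r) g i.
Proof.
move=> g0 gr; rewrite (nneseries_split 0 r); last by move=> k _; rewrite lee_fin.
rewrite add0n [X in (_ + X)%E]eseries0 ?adde0; first by rewrite big_mkord sumEFin.
by move=> i ri _; rewrite gr.
Qed.

Variables (m : nat) (t alpha beta : nat -> R).
Hypothesis tH : forall k, (1 <= k < m.+1)%N -> t k <= H.

Let a k : R := expR (- (alpha k / n%:R)).
Let b k : R := expR (- (beta k / n%:R)).
Let l := index_iota 1 m.+1.
Hypothesis tl : pairwise (fun x z => t x <= t z) l.

Definition joint_exponent (w : T) : R := \sum_(1 <= k < m.+1)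
  (alpha k * (queue_len tau N S (t k) w / n%:R) +
   beta k * (departures tau N S (t k) w / n%:R)).

(** From the exit index on, points lie beyond H, so all series are finite sums. The sums over times,
    batches and customers are exchanged, and the factor of each customer is compared time by
    time. *)
Lemma exp_joint_exponent w r : (forall i, (0%:E < tau i w)%E) ->
  exit_at tau H w r ->
  (forall i j, (tau i w < +oo)%E -> (j < N i w)%N -> 0 <= S i j w) ->
  expR (- joint_exponent w) = run_prod tau H (queue_factor tau N S a b t l) w.
Proof.
move=> pos er S0; rewrite (run_prodE _ er).
have late i k : (r <= i)%N -> (1 <= k < m.+1)%N -> ((t k)%:E < tau i w)%E.
  move=> ri km; apply: le_lt_trans (after_exit pp pos er ri).
  by rewrite lee_fin tH.
pose qi k i j : R :=
  if (tau i w <= (t k)%:E)%E && ((t k)%:E < tau i w + (S i j w)%:E)%E then 1 else 0.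
pose di k i j : R := if (tau i w + (S i j w)%:E <= (t k)%:E)%E then 1 else 0.
have qE k : (1 <= k < m.+1)%N ->
    queue_len tau N S (t k) w = \sum_(i < r) \sum_(j < N i w) qi k i j.
  move=> km; rewrite /queue_len.
  rewrite (@fine_eseries_finite (fun i => \sum_(j < N i w) qi k i j) r)//.
    by move=> i; apply: sumr_ge0 => j _; rewrite /qi; case: ifP.
  by move=> i ri; apply: big1 => j _; rewrite /qi leNgt late.
have dE k : (1 <= k < m.+1)%N ->
    departures tau N S (t k) w = \sum_(i < r) \sum_(j < N i w) di k i j.
  move=> km; rewrite /departures.
  rewrite (@fine_eseries_finite (fun i => \sum_(j < N i w) di k i j) r)//.
    by move=> i; apply: sumr_ge0 => j _; rewrite /di; case: ifP.
  move=> i ri; apply: big1 => j _; rewrite /di leNgt.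
  have tk := late _ _ ri km.
  have [ti|ti] := ltP (tau i w) +oo%E; last first.
    by move: ti; rewrite leye_eq => /eqP ->; rewrite addye// ltry.
  by rewrite (lt_le_trans tk)// leeDl// lee_fin S0.
have -> : - joint_exponent w = \sum_(i < r) \sum_(j < N i w) \sum_(k <- l)
    (- (alpha k / n%:R * qi k i j + beta k / n%:R * di k i j)).
  rewrite /joint_exponent -sumrN big_nat_cond.
  rewrite (eq_bigr (fun k => \sum_(i < r) \sum_(j < N i w)
    (- (alpha k / n%:R * qi k i j + beta k / n%:R * di k i j)))).
    rewrite -big_nat_cond exchange_big/=; apply: eq_bigr => i _.
    by rewrite exchange_big.
  move=> k; rewrite andbT => km; rewrite qE// dE//.
  transitivity (- \sum_(i < r) \sum_(j < N i w)
      (alpha k / n%:R * qi k i j + beta k / n%:R * di k i j)); last first.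
    by rewrite -sumrN; apply: eq_bigr => i _; rewrite -sumrN.
  congr (- _); rewrite !mulr_suml !mulr_sumr -big_split/=; apply: eq_bigr => i _.
  rewrite !mulr_suml !mulr_sumr -big_split/=; apply: eq_bigr => j _; ring.
rewrite expR_sum; apply: eq_bigr => i _; rewrite expR_sum; apply: eq_bigr => j _.
rewrite customer_factorE// expR_sum; apply: eq_bigr => k _.
have := exit_at_hit er (ltn_ord i); rewrite /hit /qi /di.
case: (tau i w) => [s| |]/=; rewrite ?lte_fin ?lee_fin//=; last first.
  by rewrite leye_eq andbF.
rewrite ?(lte_fin, lee_fin) lerBrDl => _.
(* Departed by t_k gives [b k]; present gives [a k]; not yet arrived gives 1. *)
case: (leP (s + S i j w) (t k)) => h.
  by rewrite andbF mulr0 add0r mulr1.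
rewrite andbT mulr0 addr0; case: ifP => _; first by rewrite mulr1.
by rewrite mulr0 oppr0 expR0.
Qed.

Lemma measurable_random_sum (K : T -> nat) (g : nat -> T -> R) :
  (forall k, measurable [set w | K w = k]) ->
  (forall j, measurable_fun setT (g j)) ->
  measurable_fun setT (fun w => \sum_(j < K w) g j w).
Proof.
move=> mK mg; apply: (@measurable_fun_cvg _ _ _ _
  (fun M w => \sum_(k < M) (K w == k)%:R * \sum_(j < k) g j w)).
  move=> M; apply: measurable_sum => k; apply: measurable_funM.
    apply: measurable_fun_bool_natr; apply: (measurable_fun_bool true).
    rewrite setTI (_ : _ @^-1` _ = [set w | K w = k])//.
    by apply/seteqP; split => w /= /eqP.
  by apply: measurable_sum => j.
move=> w _; apply: (@psum_cvg _ (fun k => K w == k) (fun k => \sum_(j < k) g j w)) => //.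
by move=> k k' /eqP <- /eqP.
Qed.

Lemma measurable_joint_exponent : measurable_fun setT joint_exponent.
Proof.
case: bq => -[mtau _ _ _] mN mS _.
have mif (c : T -> bool) : measurable_fun setT c ->
    measurable_fun setT (fun w => if c w then 1 else 0 : R).
  by move=> mc; apply: measurable_fun_ifT => //; exact: measurable_cst.
have mtS i j : measurable_fun setT (fun w => tau i w + (S i j w)%:E)%E.
  by apply: emeasurable_funD => //; exact/measurable_EFinP.
have mser (g : nat -> nat -> T -> R) : (forall i j, measurable_fun setT (g i j)) ->
    (forall i j w, 0 <= g i j w) ->
    measurable_fun setT (fun w => fine (\sum_(i <oo) (\sum_(j < N i w) g i j w)%:E)%E).
  move=> mg g0; apply: (measurableT_comp (fine_measurable measurableT)).
  apply: ge0_emeasurable_sum.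
    by move=> i w _ _; rewrite lee_fin sumr_ge0.
  by move=> i _; apply/measurable_EFinP; apply: measurable_random_sum.
apply: measurable_sum => k; apply: measurable_funD;
  (apply: measurable_funM; [exact: measurable_cst|];
   apply: measurable_funM; [|exact: measurable_cst]).
  apply: (mser (fun i j w => if (tau i w <= (t k)%:E)%E &&
    ((t k)%:E < tau i w + (S i j w)%:E)%E then 1 else 0)) => [i j|i j w]; last by case: ifP.
  apply: mif; apply: measurable_and.
    by apply: measurable_fun_lee => //; exact: measurable_cst.
  by apply: measurable_fun_lte => //; exact: measurable_cst.
apply: (mser (fun i j w =>
  if (tau i w + (S i j w)%:E <= (t k)%:E)%E then 1 else 0)) => [i j|i j w]; last by case: ifP.
by apply: mif; apply: measurable_fun_lee => //; exact: measurable_cst.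
Qed.

Hypothesis lam0 : forall x, 0 <= lam x.
Hypothesis ilam : (@lebesgue_measure R).-integrable `[0, H] (fun x => (lam x)%:E).
Hypothesis ab0 : forall k, (1 <= k <= m)%N -> 0 <= alpha k /\ 0 <= beta k.

(** The exponential and the product over points agree off three null sets: paths with a nonpositive
    point, without exit, or with a negative work. *)
Lemma joint_transform :
  (\int[P]_w (expR (- joint_exponent w))%:E =
   (expR (- fine (\int[lebesgue_measure]_(s in `]0%R, H])
      ((1 - batch_gf n mu F H a b t l s) * lam s)%:E)))%:E)%E.
Proof.
have e01 (x : R) : 0 <= x -> 0 <= expR (- (x / n%:R)) <= 1.
  by move=> x0; rewrite expR_ge0/= -[leRHS]expR0 ler_expR oppr_le0 divr_ge0.
have a01 : {in l, forall x, 0 <= a x <= 1}.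
  by move=> k; rewrite mem_index_iota => km; apply: e01; case: (ab0 km).
have b01 : {in l, forall x, 0 <= b x <= 1}.
  by move=> k; rewrite mem_index_iota => km; apply: e01; case: (ab0 km).
have [mq <-] := queue_transform H0 lam0 ilam mmu cF mF bq a01 b01 tl.
apply: ae_eq_integral => //.
- apply/measurable_EFinP; apply: measurableT_comp => //.
  by apply: measurableT_comp => //; exact: measurable_joint_exponent.
- exact/measurable_EFinP.
apply: filterS3 (points_pos_ae pp) (exit_ae lam0 pp H0) service_ge0_ae.
by move=> w pos [r er] S0 _; rewrite (exp_joint_exponent pos er S0).
Qed.

End queue_identity.

(** * Passage to the limit *)

Section exponential_limits.
Context {R : realType}.
Implicit Types (x c p : R).

Lemma cvg_divn x : (fun n => x / n.+1%:R) @ \oo --> (0 : R).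
Proof.
by rewrite -[X in _ --> X](mulr0 x); apply: cvgM; [exact: cvg_cst|exact: cvg_harmonic].
Qed.

(** Squeeze by y/(1 + y) <= 1 - exp(-y) <= y at y = x/(n+1); both bounds come from 1 + z <=
    exp(z). *)
Lemma cvg_onem_expR x : 0 <= x ->
  (fun n => n.+1%:R * (1 - expR (- (x / n.+1%:R)))) @ \oo --> x.
Proof.
move=> x0; have xn := cvg_divn x.
apply: (@squeeze_cvgr _ _ _ _ (fun n => x / (1 + x / n.+1%:R)) (cst x)).
- apply: nearW => n; set y := x / n.+1%:R.
  have y0 : 0 <= y by rewrite divr_ge0.
  have -> : x = n.+1%:R * y by rewrite /y mulrCA divff ?mulr1// pnatr_eq0.
  rewrite -mulrA !ler_pM2l ?ltr0n//; apply/andP; split; last first.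
    by rewrite lerBlDr -lerBlDl; have := expR_ge1Dx (- y); rewrite addrC; lra.
  rewrite ler_pdivrMr ?ltr_pwDl//.
  have := expR_ge1Dx y; rewrite expRN => h.
  have e0 := expR_gt0 y.
  have h2 : (expR y)^-1 * (1 + y) <= 1.
    by rewrite mulrC ler_pdivrMr// mul1r.
  rewrite mulrBl mul1r; lra.
- rewrite -[X in _ --> X]divr1; apply: cvgM; first exact: cvg_cst.
  apply: cvgV; first exact: oner_neq0.
  by rewrite -[X in _ --> X]addr0; apply: cvgD; [exact: cvg_cst|].
- exact: cvg_cst.
Qed.

Lemma cvg_expR0 x : (fun n => expR (- (x / n.+1%:R))) @ \oo --> (1 : R).
Proof.
have hx : (fun n => - (x / n.+1%:R)) @ \oo --> (0 : R).
  by rewrite -[X in _ --> X]oppr0; apply: cvgN; exact: cvg_divn.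
rewrite -[X in _ --> X]expR0.
exact: (cvg_comp _ _ hx (@continuous_expR R 0)).
Qed.

(** First-order expansion of [psi] at a = b = 1. With p the value of [psi] on the tail and Q the
    tail product of the b, the recursion reads 1 - psi = (1 - a) + a (1 - p) - th ((1 - a) - (1 -
    b)) Q, where a and Q tend to 1. *)
Lemma psi_cvg (A B th : nat -> R) l :
  {in l, forall k, 0 <= A k} -> {in l, forall k, 0 <= B k} ->
  (fun n => n.+1%:R * (1 - psi (fun k => expR (- (A k / n.+1%:R)))
       (fun k => expR (- (B k / n.+1%:R))) th l)) @ \oo -->
  \sum_(k <- l) (A k * (1 - th k) + B k * th k).
Proof.
elim: l => [|k l ih] A0 B0.
  by rewrite big_nil/=; under eq_fun do rewrite subrr mulr0; exact: cvg_cst.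
have kl : k \in k :: l by exact: mem_head.
have ll z : z \in l -> z \in k :: l by move=> zl; rewrite in_cons zl orbT.
have {}ih := ih (fun z zl => A0 z (ll z zl)) (fun z zl => B0 z (ll z zl)).
have cA := cvg_onem_expR (A0 k kl); have cB := cvg_onem_expR (B0 k kl).
have cp : (fun n => \prod_(z <- l) expR (- (B z / n.+1%:R))) @ \oo --> (1 : R).
  elim: (l) => [|z s ihs]; first by under eq_fun do rewrite big_nil; exact: cvg_cst.
  have : (fun n => expR (- (B z / n.+1%:R)) * \prod_(z <- s) expR (- (B z / n.+1%:R)))
      @ \oo --> (1 * 1 : R) by apply: cvgM => //; exact: cvg_expR0.
  rewrite mulr1; apply: cvg_trans; apply: near_eq_cvg; apply: nearW => n.
  by rewrite big_cons.
rewrite big_cons/=.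
have -> : A k * (1 - th k) + B k * th k + \sum_(j <- l) (A j * (1 - th j) + B j * th j) =
  A k + 1 * \sum_(j <- l) (A j * (1 - th j) + B j * th j) - th k * (A k - B k) * 1.
  by ring.
have : (fun n =>
   n.+1%:R * (1 - expR (- (A k / n.+1%:R))) + expR (- (A k / n.+1%:R)) * (n.+1%:R *
     (1 - psi (fun k => expR (- (A k / n.+1%:R)))
       (fun k => expR (- (B k / n.+1%:R))) th l))
   - th k * (n.+1%:R * (1 - expR (- (A k / n.+1%:R))) -
        n.+1%:R * (1 - expR (- (B k / n.+1%:R)))) *
      \prod_(z <- l) expR (- (B z / n.+1%:R))) @ \oo -->
   A k + 1 * \sum_(j <- l) (A j * (1 - th j) + B j * th j) - th k * (A k - B k) * 1.
  apply: cvgB.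
    by apply: cvgD => //; apply: cvgM => //; exact: cvg_expR0.
  by apply: cvgM => //; apply: cvgM; [exact: cvg_cst|exact: cvgB].
apply: cvg_trans; apply: near_eq_cvg; apply: nearW => n; ring.
Qed.

(* exp(- p / (1 - p)) <= 1 - p <= exp(- p) *)
Lemma cvg_expn (q : nat -> R) (k : nat -> nat) (G c : R) :
  (forall n, 0 <= q n <= 1) ->
  (fun n => n.+1%:R * (1 - q n)) @ \oo --> G ->
  (fun n => (k n)%:R / n.+1%:R) @ \oo --> c ->
  (fun n => q n ^+ k n) @ \oo --> expR (- (G * c)).
Proof.
move=> q01 qG kc.
have q1 : q @ \oo --> (1 : R).
  have : (fun n => 1 - n.+1%:R * (1 - q n) * (n.+1%:R)^-1) @ \oo --> 1 - G * 0.
    by apply: cvgB; [exact: cvg_cst|apply: cvgM => //; exact: cvg_harmonic].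
  rewrite mulr0 subr0; apply: cvg_trans; apply: near_eq_cvg; apply: nearW => n.
  by rewrite mulrAC divff ?mul1r ?pnatr_eq0// opprB addrC subrK.
have pk : (fun n => (1 - q n) * (k n)%:R) @ \oo --> G * c.
  have : (fun n => n.+1%:R * (1 - q n) * ((k n)%:R / n.+1%:R)) @ \oo --> G * c.
    exact: cvgM.
  apply: cvg_trans; apply: near_eq_cvg; apply: nearW => n /=.
  have : n.+1%:R != 0 :> R by rewrite pnatr_eq0.
  by move: (n.+1%:R : R) => M M0; field.
apply: (@squeeze_cvgr _ _ _ _ (fun n => expR (- ((1 - q n) * (k n)%:R / q n)))
                              (fun n => expR (- ((1 - q n) * (k n)%:R)))).
- near=> n; have qn : 0 < q n by near: n; apply: (cvgr_gt _ q1).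
  apply/andP; split.
    have -> : - ((1 - q n) * (k n)%:R / q n) = (k n)%:R * (- ((1 - q n) / q n)).
      by ring.
    rewrite expRM_natl; apply: lerXn2r; rewrite ?nnegrE ?expR_ge0 ?(ltW qn)//.
    rewrite expRN -[leRHS]invrK lef_pV2 ?posrE ?expR_gt0 ?invr_gt0//.
    apply: le_trans (expR_ge1Dx _).
    by rewrite le_eqVlt; apply/orP; left; apply/eqP; field; rewrite gt_eqF.
  have -> : - ((1 - q n) * (k n)%:R) = (k n)%:R * (- (1 - q n)).
    by ring.
  rewrite expRM_natl; apply: lerXn2r; rewrite ?nnegrE ?expR_ge0 ?(ltW qn)//.
  by have := expR_ge1Dx (- (1 - q n)); lra.
- apply: continuous_cvg; first exact: continuous_expR.
  apply: cvgN; rewrite -[X in _ --> X]divr1; apply: cvgM => //.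
  by apply: cvgV; [exact: oner_neq0|].
- apply: continuous_cvg; first exact: continuous_expR.
  exact: cvgN.
Unshelve. all: end_near. Qed.

Lemma ceil_ratio_cvg c (k : nat -> nat) : (forall n, ceil_is n.+1 c (k n)) ->
  (fun n => (k n)%:R / n.+1%:R) @ \oo --> c.
Proof.
move=> ck; apply: (@squeeze_cvgr _ _ _ _ (cst c) (fun n => c + (n.+1%:R)^-1)).
- apply: nearW => n; have := ceil_itv (n.+1%:R * c).
  rewrite (eqP (ck n)) intrB => /andP[h1 h2].
  rewrite ler_pdivlMr ?ltr0n// ler_pdivrMr ?ltr0n// mulrC h2/=.
  rewrite mulrDl mulVf ?pnatr_eq0// mulrC.
  have -> : (k n)%:R = (k n)%:~R :> R by [].
  by move: h1; rewrite ltrBlDr => /ltW.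
- exact: cvg_cst.
- rewrite -[X in _ --> X]addr0; apply: cvgD; first exact: cvg_cst.
  exact: cvg_harmonic.
Qed.

End exponential_limits.

(** * Limit of the batch transform and of its integral *)

Section transform_limit.
Context {R : realType}.
Variables (lam : R -> R) (mu : R -> probability R R) (F : R -> R -> R) (H : R).
Hypothesis mmu : forall A, measurable A -> measurable_fun setT (fun s => mu s A).
Hypothesis mu0 : forall s, 0 <= s -> mu s [set b : R | 0 <= b] = 1%E.
Hypothesis cF : forall s, 0 <= s -> is_cdf_nonneg (F s).
Hypothesis mF : measurable_fun setT (fun p : R * R => F p.1 p.2).
Variables (t alpha beta : nat -> R) (l : seq nat).
Hypothesis alpha0 : {in l, forall k, 0 <= alpha k}.
Hypothesis beta0 : {in l, forall k, 0 <= beta k}.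
Hypothesis tl : pairwise (fun x z => t x <= t z) l.
Hypothesis H0 : 0 < H.
Hypothesis lam0 : forall x, 0 <= lam x.
Hypothesis ilam : (@lebesgue_measure R).-integrable `[0, H] (fun x => (lam x)%:E).

Let a n k : R := expR (- (alpha k / n.+1%:R)).
Let b n k : R := expR (- (beta k / n.+1%:R)).
Let gf n s := batch_gf n.+1 mu F H (a n) (b n) t l s.

(* For t k < s the second summand vanishes as well: F s is 0 on negative numbers. *)
Definition limit_rate (s : R) : R := \sum_(k <- l)
  ((if s <= t k then alpha k else 0) * (1 - F s (t k - s)) + beta k * F s (t k - s)).

Definition limit_gf (s : R) : \bar R :=
  (\int[mu s]_b (1 - expR (- (limit_rate s * b)))%:E)%E.

Let expR01 (c : R) n : 0 <= c -> 0 <= expR (- (c / n.+1%:R)) <= 1.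
Proof.
by move=> c0; rewrite expR_ge0/= -[leRHS]expR0 ler_expR oppr_le0 divr_ge0.
Qed.

Let a01 n : {in l, forall k, 0 <= a n k <= 1}.
Proof. by move=> k kl; apply: expR01; exact: alpha0. Qed.

Let b01 n : {in l, forall k, 0 <= b n k <= 1}.
Proof. by move=> k kl; apply: expR01; exact: beta0. Qed.

(** For fixed s, replacing [alpha k] by 0 when t_k < s reproduces the factor 1 of customers not yet
    arrived, because exp(0) = 1; so [psi_cvg] applies. *)
Lemma service_gf_rate_cvg s :
  (fun n => n.+1%:R * (1 - service_gf F (a n) (b n) t l s)) @ \oo --> limit_rate s.
Proof.
have := @psi_cvg R (fun k => if s <= t k then alpha k else 0) beta
  (fun k => F s (t k - s)) l _ beta0.
move=> /(_ _)/wrap[|]; first by move=> k kl; case: ifP => _ //; exact: alpha0.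
apply: cvg_trans; apply: near_eq_cvg; apply: nearW => n /=.
congr (_ * (1 - psi _ _ _ _)); apply/funext => k.
by rewrite /a; case: ifP => _; rewrite ?mul0r ?oppr0 ?expR0.
Qed.

Let rate_measurable s : measurable_fun setT (fun b => 1 - expR (- (limit_rate s * b)) : R).
Proof.
apply: measurable_funB; first exact: measurable_cst.
by apply: measurableT_comp => //; apply: measurableT_comp => //.
Qed.

(** For each value c >= 0 of B_s the power q_n^(ceil(n c)) tends to exp(- rate c), and such c have
    full measure under [mu s]; bounded convergence integrates this. *)
Lemma onem_batch_gf_cvg s : 0 < s -> s <= H ->
  (fun n => (1 - gf n s)%:E) @ \oo --> limit_gf s.
Proof.
move=> s0 sH; pose q n := service_gf F (a n) (b n) t l s.
have q01 n : 0 <= q n <= 1.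
  exact: (service_gf01 cF (@a01 n) (@b01 n) tl (ltW s0)).
have E n : ((1 - gf n s)%:E =
    \int[mu s]_b (1 - pick_sum (ceil_is n.+1 b) (fun k => q n ^+ k))%:E)%E.
  have ip : (mu s).-integrable setT
      (EFin \o (fun b => pick_sum (ceil_is n.+1 b) (fun k => q n ^+ k))).
    apply: (@bounded_integrable _ _ _ _ _ 1); first exact: pick_ceil_measurable.
    by move=> c; exact: pick_ceil_norm.
  have i1 : (mu s).-integrable setT (EFin \o cst (1 : R)).
    by apply: (@bounded_integrable _ _ _ _ _ 1) => // c; rewrite normr1.
  under eq_integral do rewrite EFinB.
  rewrite (integralB_EFin measurableT i1 ip).
  have one : (\int[mu s]_b (cst (1 : R) b)%:E = 1)%E.
    transitivity (\int[mu s]_b (1%:E : \bar R))%E; first by [].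
    by rewrite integral_cst//= probability_setT mule1.
  rewrite one EFinB; congr (_ - _)%E.
  rewrite /gf /batch_gf s0 sH /size_gf fineK//.
  exact: (integrable_fin_num measurableT ip).
under eq_fun do rewrite E.
apply: (@bounded_cvg_integral _ _ _ (mu s) _ _ 1).
- move=> n; apply: measurable_funB; first exact: measurable_cst.
  exact: pick_ceil_measurable.
- exact: rate_measurable.
- move=> n c; have h1 := pick_ceil_norm n.+1 c (q01 n).
  have h0 := pick_ceil_ge0 n.+1 c (proj1 (andP (q01 n))).
  rewrite ger0_norm; first by rewrite lerBlDr lerDl.
  by rewrite subr_ge0; apply: le_trans h1; exact: ler_norm.
- have mb : measurable [set c : R | 0 <= c].
    by rewrite -set_itvcy; exact: measurable_itv.
  apply: filterS (ae_prob1 mb (mu0 (ltW s0))) => c /= c0.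
  pose k n := `|Num.ceil (n.+1%:R * c)|%N.
  have ck n : ceil_is n.+1 c (k n).
    rewrite /ceil_is /k gez0_abs// ceil_ge0.
    by apply: lt_le_trans (_ : 0 <= _); rewrite ?ltrN10// mulr_ge0.
  apply: cvgB; first exact: cvg_cst.
  have := cvg_expn q01 (@service_gf_rate_cvg s) (ceil_ratio_cvg ck).
  apply: cvg_trans; apply: near_eq_cvg; apply: nearW => n.
  rewrite (@pick_sumE _ (ceil_is n.+1 c) _ (k n))// => i j.
  exact: ceil_is_uniq.
Qed.

(** The bounds are inherited from the prelimits [1 - gf n s], without inspecting the sign of the
    rate. *)
Lemma limit_gf01 s : 0 < s -> s <= H -> (0 <= limit_gf s <= 1)%E.
Proof.
move=> s0 sH; have c := @onem_batch_gf_cvg s s0 sH.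
have g01 n := batch_gf01 n.+1 mu H cF (@a01 n) (@b01 n) tl s.
rewrite -(cvg_lim _ c)//; apply/andP; split.
  apply: lime_ge; first by apply/cvg_ex; exists (limit_gf s).
  apply: nearW => n; rewrite lee_fin subr_ge0.
  by case/andP: (g01 n).
apply: lime_le; first by apply/cvg_ex; exists (limit_gf s).
apply: nearW => n; rewrite lee_fin lerBlDr lerDl.
by case/andP: (g01 n).
Qed.

Lemma limit_gf_fin s : 0 < s -> s <= H -> limit_gf s \is a fin_num.
Proof.
move=> s0 sH; have /andP[g0 g1] := limit_gf01 s0 sH.
by rewrite fin_numE gt_eqF ?lt_eqF// ?(le_lt_trans g1) ?ltry// (lt_le_trans _ g0) ?ltNyr.
Qed.

Let ilam' : (@lebesgue_measure R).-integrable `]0, H] (fun x => (lam x)%:E).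
Proof.
by apply: integrableS ilam => //; apply: subset_itvr; rewrite bnd_simp.
Qed.

Let mlam : measurable_fun `]0, H] lam.
Proof. by apply/measurable_EFinP; exact: measurable_int ilam'. Qed.

Let gf_cvg s : `]0, H]%classic s -> (fun n => (1 - gf n s) * lam s) @ \oo -->
  fine (limit_gf s) * lam s.
Proof.
rewrite /= in_itv/= => /andP[s0 sH]; apply: cvgM; last exact: cvg_cst.
have c := @onem_batch_gf_cvg s s0 sH.
by move: c; rewrite -[limit_gf s]fineK ?limit_gf_fin// => /fine_cvg.
Qed.

Let gf_measurable n : measurable_fun `]0, H] (fun s => (1 - gf n s) * lam s).
Proof.
apply: measurable_funM => //; apply: measurable_funB; first exact: measurable_cst.
by apply: measurable_funTS; exact: measurable_batch_gf.
Qed.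

Let gf_bound n s : `|(1 - gf n s) * lam s| <= lam s.
Proof.
have /andP[g0 g1] := batch_gf01 n.+1 mu H cF (@a01 n) (@b01 n) tl s.
rewrite normrM (ger0_norm (lam0 s)) ler_piMl//.
by rewrite ger0_norm ?subr_ge0// lerBlDr lerDl.
Qed.

(** Measurability in s of the inner integral is obtained from its being a pointwise limit of the
    functions [1 - gf n s]; the bound 1 then leaves [lam] as dominating function. *)
Lemma limit_integrable : (@lebesgue_measure R).-integrable `]0, H]
  (fun s => limit_gf s * (lam s)%:E)%E.
Proof.
have e s : `]0, H]%classic s -> (limit_gf s * (lam s)%:E)%E = (fine (limit_gf s) * lam s)%:E.
  rewrite /= in_itv/= => /andP[s0 sH].
  by rewrite EFinM fineK// limit_gf_fin.
apply: (@le_integrable _ _ R (@lebesgue_measure R) `]0%R, H] (measurable_itv _)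
    _ (EFin \o lam)); last exact: ilam'.
  apply: (eq_measurable_fun (fun s => (fine (limit_gf s) * lam s)%:E)).
    by move=> s /set_mem /e ->.
  apply/measurable_EFinP; apply: (@measurable_fun_cvg _ _ _ _
    (fun n s => (1 - gf n s) * lam s)); first exact: gf_measurable.
  exact: gf_cvg.
move=> s Ds; rewrite e//= lee_fin normrM ler_piMl//.
move: Ds; rewrite /= in_itv/= => /andP[s0 sH].
have /andP[g0 g1] := limit_gf01 s0 sH.
by rewrite ger0_norm ?fine_ge0// -lee_fin fineK// limit_gf_fin.
Qed.

Lemma transform_cvg :
  (fun n => (expR (- fine (\int[lebesgue_measure]_(s in `]0%R, H])
      ((1 - gf n s) * lam s)%:E)))%:E)%E @ \oo -->
  (expR (- fine (\int[lebesgue_measure]_(s in `]0%R, H])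
      (limit_gf s * (lam s)%:E))))%:E%E.
Proof.
have c : (fun n => \int[lebesgue_measure]_(s in `]0%R, H])
      ((1 - gf n s) * lam s)%:E)%E @ \oo -->
    (\int[lebesgue_measure]_(s in `]0%R, H]) (fine (limit_gf s) * lam s)%:E)%E.
  apply: (@dominated_cvg_real _ _ _ (@lebesgue_measure R) `]0, H]
    (fun n s => (1 - gf n s) * lam s) _ lam) => //.
have e : (\int[lebesgue_measure]_(s in `]0%R, H]) (fine (limit_gf s) * lam s)%:E =
    \int[lebesgue_measure]_(s in `]0%R, H]) (limit_gf s * (lam s)%:E))%E.
  apply: eq_integral => s /set_mem; rewrite /= in_itv/= => /andP[s0 sH].
  by rewrite EFinM fineK// limit_gf_fin.
rewrite e in c; apply: cvg_EFin; first exact: nearW.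
apply: continuous_cvg; first exact: continuous_expR.
apply: cvgN; apply: fine_cvg; rewrite fineK//.
by apply: integrable_fin_num => //; exact: limit_integrable.
Qed.

End transform_limit.

(** After the limit the exponent is one integral over (0, t_m], which has to be cut at the t_k. On
    (t_{k-1}, t_k] the terms of [limit_rate] with index below k vanish, which is why the inner sum
    starts at k. *)
Theorem theorem4 (R : realType)
    (lam : R -> R) (mu : R -> probability R R) (F : R -> R -> R)
    (d : nat -> measure_display) (Omega : forall n : nat, measurableType (d n))
    (P : forall n : nat, probability (Omega n) R)
    (tau : forall n : nat, nat -> Omega n -> \bar R)
    (N : forall n : nat, nat -> Omega n -> nat)
    (S : forall n : nat, nat -> nat -> Omega n -> R) :
  (forall x, 0 <= lam x) ->
  (forall t, 0 <= t -> lebesgue_measure.-integrable `[0, t] (fun x => (lam x)%:E)) ->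
  (forall A, measurable A -> measurable_fun setT (fun s => mu s A)) ->
  (forall s, 0 <= s -> mu s [set b : R | 0 <= b] = 1%E) ->
  (forall s, 0 <= s -> is_cdf_nonneg (F s)) ->
  measurable_fun setT (fun p : R * R => F p.1 p.2) ->
  (forall n, (0 < n)%N -> batch_queue n (P n) lam mu F (tau n) (N n) (S n)) ->
  forall (m : nat) (t alpha beta : nat -> R),
  (0 < m)%N -> t 0%N = 0 ->
  (forall k, (k < m)%N -> t k < t k.+1) ->
  (forall k, (1 <= k <= m)%N -> 0 <= alpha k /\ 0 <= beta k) ->
  (fun n : nat =>
     (\int[P n.+1]_w
        (expR (- \sum_(1 <= k < m.+1)
            (alpha k * (queue_len (tau n.+1) (N n.+1) (S n.+1) (t k) w / n.+1%:R)
             + beta k * (departures (tau n.+1) (N n.+1) (S n.+1) (t k) w / n.+1%:R)))%R)%:E)%E)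
  @ \oo -->
  (expR (- \sum_(1 <= k < m.+1)
      fine (\int[lebesgue_measure]_(s in `[t k.-1, t k])
        ((\int[mu s]_b
            (1 - expR (- (\sum_(k <= x < m.+1)
                 (alpha x * (1 - F s (t x - s)) + beta x * F s (t x - s))) * b))%R%:E)
         * (lam s)%:E))%E)%R)%:E.
Proof.
move=> lam0 ilam mmu mu0 cF mF bq m t alpha beta m0 t0 tt ab0.
pose l := index_iota 1 m.+1.
have tnd := nondecreasing_on tt.
have tH k : (1 <= k < m.+1)%N -> t k <= t m.
  by move=> /andP[_ km]; apply: tnd; rewrite -ltnS km leqnn.
have H0 : 0 < t m.
  rewrite -t0; case: (m) m0 tt tnd => // m' _ tt tnd.
  by apply: lt_le_trans (tt 0%N isT) _; apply: tnd; rewrite leqnn andbT.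
have tl : pairwise (fun x z => t x <= t z) l.
  apply/(pairwiseP 0%N) => i j; rewrite !inE size_iota subn1/= => im jm ij.
  rewrite !nth_iota ?subn1// !add1n; apply: tnd.
  by rewrite ltnS ltnW//=.
have al0 : {in l, forall k, 0 <= alpha k}.
  by move=> k; rewrite mem_index_iota => km; case: (ab0 k km).
have be0 : {in l, forall k, 0 <= beta k}.
  by move=> k; rewrite mem_index_iota => km; case: (ab0 k km).
have il := ilam _ (ltW H0).
under eq_fun => n.
  rewrite (@joint_transform _ _ _ n.+1 (P n.+1) lam mu F (tau n.+1) (N n.+1)
    (S n.+1) (t m) H0 mmu cF mF (bq n.+1 isT) m t alpha beta tH tl lam0 il ab0).
  over.
pose gf s := (limit_gf mu F t alpha beta l s * (lam s)%:E)%E.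
have igf : (@lebesgue_measure R).-integrable `]0, t m] gf.
  by apply: limit_integrable => //.
rewrite [\sum_(1 <= k < m.+1) _](_ : _ =
    fine (\int[lebesgue_measure]_(s in `]0%R, t m]) gf s)%E).
  by apply: transform_cvg => //.
(* limit_gf is only known to be nonnegative on (0, t m], whence the truncation. *)
have -> : (\int[lebesgue_measure]_(s in `]0%R, t m]) gf s =
    \int[lebesgue_measure]_(s in `]t 0%N, t m]) `|gf s|)%E.
  rewrite t0; apply: eq_integral => s /set_mem; rewrite /= in_itv/= => /andP[s0 sH].
  rewrite gee0_abs// mule_ge0 ?lee_fin//.
  by have /andP[] := limit_gf01 mu0 cF al0 be0 tl s0 sH.
have igf' : (@lebesgue_measure R).-integrable `]t 0%N, t m] (fun s => `|gf s|%E).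
  by rewrite t0; exact: integrable_abse.
rewrite (integral_partition tt)//; last exact: measurable_int igf'.
have sub j : (j < m)%N -> `]t j, t j.+1] `<=` `]t 0%N, t m].
  move=> jm; apply: subset_itv; rewrite bnd_simp; apply: tnd.
    by rewrite leq0n/= ltnW.
  by rewrite jm leqnn.
rewrite -sum_fine; last first.
  move=> j _; apply: integrable_fin_num => //.
  apply: (@integrableS _ _ R (@lebesgue_measure R) `]t 0%N, t m] `]t j, t j.+1]) => //.
  exact: (sub j (ltn_ord j)).
rewrite big_add1 big_mkord/=; apply: eq_bigr => j _; congr fine.
have jm := ltn_ord j.
have e s : `]t j, t j.+1]%classic s -> `|gf s|%E =
  ((\int[mu s]_b
     (1 - expR (- (\sum_(j.+1 <= x < m.+1)
        (alpha x * (1 - F s (t x - s)) + beta x * F s (t x - s))) * b))%R%:E)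
   * (lam s)%:E)%E.
  move=> Ds; have := sub j jm s Ds; rewrite /= in_itv/= t0 => /andP[s0 sH].
  move: Ds; rewrite /= in_itv/= => /andP[js sj].
  rewrite gee0_abs; last first.
    rewrite mule_ge0 ?lee_fin//.
    by have /andP[] := limit_gf01 mu0 cF al0 be0 tl s0 sH.
  congr (_ * _)%E; apply: eq_integral => c _; congr (1 - expR _)%:E.
  rewrite mulNr; congr (- (_ * _)); rewrite /limit_rate /l.
  rewrite (big_cat_nat (n := j.+1))//=; last exact: ltnW.
  (* For x <= j the batch arrives after t_x: the alpha term is switched off, and [F s] vanishes at
     the negative number t_x - s. *)
  rewrite [X in X + _]big1_seq ?add0r; last first.
    move=> x /andP[_]; rewrite mem_index_iota => /andP[x1 xj].
    have xs : t x < s by apply: le_lt_trans js; apply: tnd; rewrite -ltnS xj ltnW.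
    have [_ _ Fneg _] := cF _ (ltW s0).
    by rewrite leNgt xs/= mul0r add0r Fneg ?mulr0// subr_lt0.
  apply: eq_big_nat => x /andP[jx xm]; rewrite ifT//.
  by apply: (le_trans sj); apply: tnd; rewrite jx -ltnS.
(* The statement integrates over closed intervals, the partition over left-open ones; the left
   endpoint is Lebesgue-null. *)
rewrite -integral_itv_obnd_cbnd; last first.
  apply: (eq_measurable_fun (fun s => `|gf s|%E)).
    by move=> s /set_mem; exact: e.
  by apply: measurable_funS (measurable_int _ igf') => //; exact: sub.
by apply: eq_integral => s /set_mem Ds; rewrite e.
Qed.
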